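(* Let $\Sigma$ be a germ at $0$ of a closed subset of $\mathbb{R}^n$ with $0\in\Sigma$, let $r$ be a positive integer, $n\ge p$, and $f\in\mathcal{E}_{[r+1]}(n,p)$. If $f$ satisfies the second relative Kuo condition $(K^\delta_\Sigma)$ — i.e. for every $g\in\mathcal{E}_{[r+1]}(n,p)$ with $j^rg(\Sigma;0)=j^rf(\Sigma;0)$ there are $C,\alpha,\delta,\bar w>0$ (depending on $g$) such that $\kappa(df(x))\ge C\,d(x,\Sigma)^{r-\delta}$ for all $x\in\mathcal{H}^\Sigma_{r+1}(g;\bar w)\cap\{\|x\|<\alpha\}$ — then $j^rf(\Sigma;0)$ is $\Sigma$-$V$-sufficient in $\mathcal{E}_{[r+1]}(n,p)$.
   Context: $\mathcal{E}_{[s]}(n,p)$ is the set of germs at $0$ of $C^s$ maps $(\mathbb{R}^n,0)\to(\mathbb{R}^p,0)$. $j^rg(\Sigma;0)=j^rf(\Sigma;0)$ means the $r$-jets of $f,g$ coincide at every point of $\Sigma\cap U$ for some neighbourhood $U$ of $0$. Two germs $f,g$ are $\Sigma$-$V$-equivalent if the germs at $0$ of $f^{-1}(0)$ and $g^{-1}(0)$ are homeomorphic by a homeomorphism fixing $f^{-1}(0)\cap\Sigma$ pointwise; the relative jet is $\Sigma$-$V$-sufficient in $\mathcal{E}_{[s]}(n,p)$ if any two of its realisations there are $\Sigma$-$V$-equivalent. $d(x,\Sigma)$ is the distance to $\Sigma$. $\kappa(df(x))=\min_i\operatorname{dist}(\operatorname{grad}f_i(x),\operatorname{span}\{\operatorname{grad}f_j(x):j\ne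 i\})$. $\mathcal{H}^\Sigma_{d}(g;\bar w)=\{x:\|g(x)\|\le\bar w\,d(x,\Sigma)^{d}\}$. *)

(* Defs.v *)
From Stdlib Require Import Reals ClassicalEpsilon.
From mathcomp Require Import all_boot.
Set Implicit Arguments.
Unset Strict Implicit.
Unset Printing Implicit Defensive.
Local Open Scope R_scope.

Definition Rn (n : nat) := 'I_n -> R.
Definition vzero (n : nat) : Rn n := fun _ => 0.
Arguments vzero n : clear implicits.
Definition vsub n (x y : Rn n) : Rn n := fun i => x i - y i.
Definition sumR n (F : 'I_n -> R) : R := \big[Rplus/0]_(i < n) F i.
Definition vnorm n (x : Rn n) : R := sqrt (sumR (fun i => x i * x i)).
Definition vdist n (x y : Rn n) : R := vnorm (vsub x y).

(** Infimum of a set of reals (classical choice); only used on nonempty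
    sets bounded below by 0. *)
Definition Rinf (S : R -> Prop) : R :=
  epsilon (inhabits 0) (fun m => is_lub (fun t => S (- t)) (- m)).

Definition dist_set n (Sigma : Rn n -> Prop) (x : Rn n) : R :=
  Rinf (fun t => exists y, Sigma y /\ t = vdist x y).

Definition rn_open n (U : Rn n -> Prop) : Prop :=
  forall x, U x -> exists eta, 0 < eta /\ forall y, vdist y x < eta -> U y.
Definition rn_closed n (S : Rn n -> Prop) : Prop :=
  rn_open (fun x => ~ S x).

Definition shift n (x : Rn n) (i : 'I_n) (t : R) : Rn n :=
  fun k => x k + (if k == i then t else 0).
Definition has_partial n (F : Rn n -> R) (i : 'I_n) (x : Rn n) (L : R) :=
  derivable_pt_lim (fun t => F (shift x i t)) 0 L.
Definition pd n (i : 'I_n) (F : Rn n -> R) : Rn n -> R :=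
  fun x => epsilon (inhabits 0) (fun L => has_partial F i x L).
Definition pdl n (l : seq 'I_n) (F : Rn n -> R) : Rn n -> R :=
  foldr (@pd n) F l.

Definition cont_on n (U : Rn n -> Prop) (F : Rn n -> R) : Prop :=
  forall x, U x -> forall eps, 0 < eps ->
    exists eta, 0 < eta /\ forall y, vdist y x < eta -> Rabs (F y - F x) < eps.

Fixpoint Cs n (s : nat) (U : Rn n -> Prop) (F : Rn n -> R) : Prop :=
  match s with
  | O => cont_on U F
  | S s' => cont_on U F /\
      forall i : 'I_n, exists G : Rn n -> R,
        (forall x, U x -> has_partial F i x (G x)) /\ Cs s' U G
  end.

Definition rn_ball n (eps : R) : Rn n -> Prop := fun x => vnorm x < eps.

(** f in E_[s](n,p): a germ at 0 of a C^s map (R^n,0) -> (R^p,0),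
    represented by a total map that is C^s on some rn_ball around 0. *)
Definition germ_in n p (s : nat) (f : Rn n -> Rn p) : Prop :=
  f (vzero n) = vzero p /\
  exists eps, 0 < eps /\ forall k : 'I_p, Cs s (rn_ball eps) (fun x => f x k).

Definition jet_eq n p (Sigma : Rn n -> Prop) (r : nat) (g f : Rn n -> Rn p) :=
  exists eps, 0 < eps /\ forall a, Sigma a -> vnorm a < eps ->
    forall (l : seq 'I_n) (k : 'I_p), (size l <= r)%nat ->
      pdl l (fun x => g x k) a = pdl l (fun x => f x k) a.

Definition grad n p (f : Rn n -> Rn p) (k : 'I_p) (x : Rn n) : Rn n :=
  fun j => pd j (fun y => f y k) x.

Definition kappa_df n p (f : Rn n -> Rn p) (x : Rn n) : R :=
  Rinf (fun t => exists i : 'I_p, t =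
    Rinf (fun u => exists c : 'I_p -> R, u =
      vdist (grad f i x)
            (fun m => sumR (fun j : 'I_p =>
                         if j == i then 0 else c j * grad f j x m)))).

(** real power d^e for d >= 0, with the convention 0^e = 0 *)
Definition rpow (d e : R) : R := if Rlt_dec 0 d then Rpower d e else 0.

Definition Kuo_delta n p (Sigma : Rn n -> Prop) (r : nat) (f : Rn n -> Rn p) :=
  forall g, germ_in (r + 1) g -> jet_eq Sigma r g f ->
    exists C alpha delta wbar,
      0 < C /\ 0 < alpha /\ 0 < delta /\ 0 < wbar /\
      forall x, vnorm x < alpha ->
        vnorm (g x) <= wbar * (dist_set Sigma x) ^ (r + 1) ->
        kappa_df f x >= C * rpow (dist_set Sigma x) (INR r - delta).

Definition zeroset n p (f : Rn n -> Rn p) : Rn n -> Prop :=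
  fun x => f x = vzero p.

Definition rel_cont n (A : Rn n -> Prop) (h : Rn n -> Rn n) : Prop :=
  forall x, A x -> forall eps, 0 < eps -> exists eta, 0 < eta /\
    forall y, A y -> vdist y x < eta -> vdist (h y) (h x) < eps.

Definition SigmaV_equiv n p (Sigma : Rn n -> Prop) (f g : Rn n -> Rn p) :=
  exists (U U' : Rn n -> Prop) (h h' : Rn n -> Rn n),
    rn_open U /\ U (vzero n) /\ rn_open U' /\ U' (vzero n) /\
    let A := fun x => zeroset f x /\ U x in
    let B := fun y => zeroset g y /\ U' y in
    (forall x, A x -> B (h x) /\ h' (h x) = x) /\
    (forall y, B y -> A (h' y) /\ h (h' y) = y) /\
    rel_cont A h /\ rel_cont B h' /\
    (forall x, A x -> Sigma x -> h x = x).

Definition SigmaV_sufficient n p (Sigma : Rn n -> Prop) (r s : nat)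
    (f : Rn n -> Rn p) :=
  forall g1 g2, germ_in s g1 -> germ_in s g2 ->
    jet_eq Sigma r g1 f -> jet_eq Sigma r g2 f ->
    SigmaV_equiv Sigma g1 g2.

(* Main.v *)
(** Join two realisations by [F_t = (1 - t) g1 + t g2] and follow the zeros of
    [F_t].  Writing [d] for the distance to [Sigma] and [D_t] for the Jacobian
    of [F_t], Taylor's formula gives [|g2 - g1| <= K d^(r+1)] and
    [|D_t - df| <= K d^r]; since [d^(r-delta)] dominates [d^r], the Kuo condition
    for [F_t] yields [|D_t^T u| >= d^r |u|] on a horn neighbourhood of the zeros of
    [F_t], with constants that are uniform in [t] by compactness of [[0,1]].
    There the field [V = - D_t^T (D_t D_t^T)^-1 (g2 - g1)] satisfies
    [D_t V = - (g2 - g1)] and [|V| <= K d], so its integral curves preserve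
    [F_t = 0], and by Gronwall's inequality applied to [|gam - a|], [a] in
    [Sigma], they stay away from [Sigma] and move points by at most a multiple
    of [d].  The time-one map, extended by the identity on [Sigma], is the
    required homeomorphism; its inverse is the same map for the reversed
    deformation. *)
From Stdlib Require Import Reals Lra Classical ClassicalEpsilon.
From Stdlib Require Import FunctionalExtensionality PropExtensionality.
From mathcomp Require Import all_boot all_algebra all_fingroup.
From mathcomp Require Import Rstruct.
From Coquelicot Require Import Coquelicot.
Require Import Defs.
Set Implicit Arguments.
Unset Strict Implicit.
Unset Printing Implicit Defensive.
Local Open Scope R_scope.

(** * Finite sums and Euclidean distance *)

(** No Lipschitz constant for [V] is available up to [Sigma]: the field inverts D_t D_t^T, and the
    lower bound for D_t^T degenerates like d^r. Hence no flow is built across [Sigma]. For each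
    starting point x the determinant is truncated from below at a level [eta] that depends only on
    the distance from x to [Sigma]; with time and space clamped as well, the field becomes globally
    Lipschitz and Picard-Lindeloef applies. Gronwall shows that the solution keeps a fixed fraction
    of its initial distance, so the truncation is never felt. Continuity of the time-one map off
    [Sigma] comes from the Lipschitz constant of the truncated field; at a point a of [Sigma] only
    |y - a| <= E |x - a| is left, and it suffices. The gain [delta] in the exponent is what lets the
    Kuo bound absorb the error K d^r between D_t and df, however small C and however large K are.
    Class C^(r+1) with r >= 1 makes D_t Lipschitz, as uniqueness of trajectories demands. *)

Lemma sumR_ge0 n (F : 'I_n -> R) : (forall i, 0 <= F i) -> 0 <= sumR F.
Proof. by move=> h; apply: (big_ind (fun x => 0 <= x)) => [|x y|i _] //; lra. Qed.

Lemma sumRD n (F G : 'I_n -> R) : sumR (fun i => F i + G i) = sumR F + sumR G.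
Proof. exact: big_split. Qed.

Lemma sumRZ n c (F : 'I_n -> R) : sumR (fun i => c * F i) = c * sumR F.
Proof. by rewrite /sumR big_distrr. Qed.

Lemma eq_sumR n (F G : 'I_n -> R) : (forall i, F i = G i) -> sumR F = sumR G.
Proof. by move=> h; apply: eq_bigr. Qed.

Lemma sumRB n (F G : 'I_n -> R) : sumR (fun i => F i - G i) = sumR F - sumR G.
Proof.
rewrite (_ : sumR F - sumR G = sumR F + (-1) * sumR G); last ring.
by rewrite -sumRZ -sumRD; apply: eq_sumR => i; ring.
Qed.

Lemma ler_sumR n (F G : 'I_n -> R) :
  (forall i, F i <= G i) -> sumR F <= sumR G.
Proof.
move=> h; have : 0 <= sumR (fun i => G i - F i).
  by apply: sumR_ge0 => i; have := h i; lra.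
by rewrite sumRB; lra.
Qed.

Lemma sumR_const n c : sumR (fun _ : 'I_n => c) = INR n * c.
Proof.
elim: n => [|n ih]; first by rewrite /sumR big_ord0 /=; ring.
by rewrite /sumR big_ord_recl S_INR -[\big[_/_]_(_ < _) _]/(sumR (fun _ => c)) ih; ring.
Qed.

Lemma sumR_eq0 n (F : 'I_n -> R) : (forall i, F i = 0) -> sumR F = 0.
Proof. by move=> h; rewrite /sumR big1. Qed.

Lemma exchange_sumR n m (F : 'I_n -> 'I_m -> R) :
  sumR (fun i => sumR (F i)) = sumR (fun j => sumR (fun i => F i j)).
Proof. exact: exchange_big. Qed.

Lemma sumRD1 n (F : 'I_n -> R) i :
  sumR F = F i + sumR (fun j => if j == i then 0 else F j).
Proof.
rewrite /sumR (bigD1 i) //= [in RHS](bigD1 i) //= eqxx Rplus_0_l.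
by congr (_ + _); apply: eq_bigr => j /negbTE ->.
Qed.

Lemma term_le_sumR n (F : 'I_n -> R) i : (forall j, 0 <= F j) -> F i <= sumR F.
Proof.
move=> h; rewrite (sumRD1 F i); suff: 0 <= sumR (fun j => if j == i then 0 else F j) by lra.
by apply: sumR_ge0 => j; case: (j == i) => //; lra.
Qed.

Lemma Rabs_sumR n (F : 'I_n -> R) : Rabs (sumR F) <= sumR (fun i => Rabs (F i)).
Proof.
apply: Rabs_le; split.
  have := @ler_sumR n (fun i => - Rabs (F i)) F.
  have -> : sumR (fun i => - Rabs (F i)) = - sumR (fun i => Rabs (F i)).
    rewrite (_ : - sumR _ = -1 * sumR (fun i => Rabs (F i))); last ring.
    by rewrite -sumRZ; apply: eq_sumR => i; ring.
  by apply=> i; have := Rle_abs (- F i); rewrite Rabs_Ropp; lra.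
by apply: ler_sumR => i; exact: Rle_abs.
Qed.

Lemma Rabs_sumR_le n (F : 'I_n -> R) c :
  (forall i, Rabs (F i) <= c) -> Rabs (sumR F) <= INR n * c.
Proof.
by move=> h; apply: Rle_trans (Rabs_sumR F) _; rewrite -sumR_const; exact: ler_sumR.
Qed.

Definition dot n (x y : Rn n) : R := sumR (fun i => x i * y i).

Lemma dot_ge0 n (x : Rn n) : 0 <= dot x x.
Proof. by apply: sumR_ge0 => i; nra. Qed.

Lemma vnorm_ge0 n (x : Rn n) : 0 <= vnorm x.
Proof. exact: sqrt_pos. Qed.

Lemma vnorm_sqr n (x : Rn n) : vnorm x * vnorm x = dot x x.
Proof. exact: sqrt_sqrt (dot_ge0 x). Qed.

Lemma coord_le_vnorm n (x : Rn n) i : Rabs (x i) <= vnorm x.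
Proof.
rewrite -sqrt_Rsqr_abs; apply: sqrt_le_1_alt.
by apply: (@term_le_sumR n (fun i => x i * x i)) => j; nra.
Qed.

Lemma vnorm_le_sum n (x : Rn n) : vnorm x <= sumR (fun i => Rabs (x i)).
Proof.
set S := sumR _; have S0 : 0 <= S by apply: sumR_ge0 => i; exact: Rabs_pos.
rewrite -(sqrt_square S) //; apply: sqrt_le_1_alt.
rewrite {2}/S -sumRZ; apply: ler_sumR => i.
have h : Rabs (x i) <= S.
  by apply: (@term_le_sumR n (fun i => Rabs (x i))) => j; exact: Rabs_pos.
have := Rabs_pos (x i); have -> : x i * x i = Rabs (x i) * Rabs (x i).
  by rewrite -Rabs_mult Rabs_pos_eq //; nra.
nra.
Qed.

Lemma vnorm_le_coord n (x : Rn n) c :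
  (forall i, Rabs (x i) <= c) -> vnorm x <= INR n * c.
Proof.
by move=> h; apply: Rle_trans (vnorm_le_sum x) _; rewrite -sumR_const; exact: ler_sumR.
Qed.

Lemma vnorm_eq0 n (x : Rn n) : vnorm x = 0 -> x = @vzero n.
Proof.
move=> h; apply: functional_extensionality => i; have := coord_le_vnorm x i.
by rewrite h /vzero => h1; apply: Rabs_eq_0; have := Rabs_pos (x i); lra.
Qed.

Lemma cauchy_schwarz n (x y : Rn n) : Rabs (dot x y) <= vnorm x * vnorm y.
Proof.
case: (Req_dec (vnorm y) 0) => [y0|y0].
  rewrite y0 (vnorm_eq0 y0) /dot sumR_eq0 ?Rabs_R0; first lra.
  by move=> i; rewrite /vzero; ring.
have E a b : sumR (fun i => (a * x i - b * y i) * (a * x i - b * y i)) =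
   a * a * dot x x - 2 * a * b * dot x y + b * b * dot y y.
  by rewrite /dot -!sumRZ -sumRB -sumRD; apply: eq_sumR => i; ring.
have H : 0 <= dot y y * (dot x x * dot y y - dot x y * dot x y).
  have := E (dot y y) (dot x y); set S := sumR _ => ES.
  have S0 : 0 <= S by apply: sumR_ge0 => i; exact: Rle_0_sqr.
  nra.
rewrite -!vnorm_sqr in H; clear E; have yp := vnorm_ge0 y; have xp := vnorm_ge0 x.
have H2 : dot x y * dot x y <= (vnorm x * vnorm y) * (vnorm x * vnorm y).
  have : 0 < vnorm y * vnorm y by nra.
  move=> h; have := Rmult_le_reg_l _ 0
    (vnorm x * vnorm x * (vnorm y * vnorm y) - dot x y * dot x y) h.
  by nra.
have p0 : 0 <= vnorm x * vnorm y by nra.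
by apply: Rabs_le; split; nra.
Qed.

Lemma vnorm_triangle n (x y z : Rn n) : (forall i, z i = x i + y i) ->
  vnorm z <= vnorm x + vnorm y.
Proof.
move=> h; have xp := vnorm_ge0 x; have yp := vnorm_ge0 y; have zp := vnorm_ge0 z.
have E : dot z z = dot x x + 2 * dot x y + dot y y.
  by rewrite /dot -sumRZ -!sumRD; apply: eq_sumR => i; rewrite h; ring.
have := Rle_trans _ _ _ (Rle_abs _) (cauchy_schwarz x y).
rewrite -!vnorm_sqr in E; nra.
Qed.

Lemma vdist_triangle n (y x z : Rn n) : vdist x z <= vdist x y + vdist y z.
Proof. by apply: vnorm_triangle => i; rewrite /vsub; ring. Qed.

Lemma vdist_sym n (x y : Rn n) : vdist x y = vdist y x.
Proof.
by rewrite /vdist /vnorm; congr sqrt; apply: eq_sumR => i; rewrite /vsub; ring.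
Qed.

Lemma vdist_ge0 n (x y : Rn n) : 0 <= vdist x y.
Proof. exact: vnorm_ge0. Qed.

Lemma vdist0 n (x y : Rn n) : vdist x y = 0 -> x = y.
Proof.
move=> /vnorm_eq0 h; apply: functional_extensionality => i.
by have := f_equal (fun f => f i) h; rewrite /vsub /vzero; lra.
Qed.

Lemma vdistxx n (x : Rn n) : vdist x x = 0.
Proof.
rewrite /vdist /vnorm sumR_eq0 ?sqrt_0 // => i; rewrite /vsub; ring.
Qed.

Lemma vdistx0 n (x : Rn n) : vdist x (@vzero n) = vnorm x.
Proof.
rewrite /vdist /vnorm; congr sqrt; apply: eq_sumR => i; rewrite /vsub /vzero; ring.
Qed.

Lemma coord_le_vdist n (x y : Rn n) i : Rabs (x i - y i) <= vdist x y.
Proof. exact: (coord_le_vnorm (vsub x y)). Qed.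

Lemma vdist_le_coord n (x y : Rn n) c :
  (forall i, Rabs (x i - y i) <= c) -> vdist x y <= INR n * c.
Proof. exact: (@vnorm_le_coord n (vsub x y)). Qed.

(** * Infima and the distance to a set *)

Section Infimum.
Variable S : R -> Prop.
Hypothesis S_ge0 : forall t, S t -> 0 <= t.

(** [Rinf] is a choice operator, meaningful only once an infimum exists; the element [t] and the
    bound 0 supply it through completeness. *)
Lemma Rinf_lub t : S t -> is_lub (fun t => S (- t)) (- Rinf S).
Proof.
move=> St; apply: (epsilon_spec (inhabits 0) (fun m => is_lub (fun t => S (- t)) (- m))).
have [||m hm] := completeness (fun t => S (- t)).
- by exists 0 => u /S_ge0; lra.
- by exists (- t); rewrite Ropp_involutive.
- by exists (- m); rewrite Ropp_involutive.
Qed.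

Lemma Rinf_le t : S t -> Rinf S <= t.
Proof.
move=> St; have [ub _] := Rinf_lub St; have := ub (- t).
by rewrite Ropp_involutive => /(_ St); lra.
Qed.

Lemma Rinf_ge t m : S t -> (forall u, S u -> m <= u) -> m <= Rinf S.
Proof.
move=> St h; have [_ lb] := Rinf_lub St.
suff: - Rinf S <= - m by lra.
by apply: lb => u /h; lra.
Qed.

End Infimum.

Section DistSet.
Variables (n : nat) (Sigma : Rn n -> Prop) (a0 : Rn n).
Hypothesis Sa0 : Sigma a0.

Lemma dist_set_le x a : Sigma a -> dist_set Sigma x <= vdist x a.
Proof. by move=> Sa; apply: Rinf_le => [t [y [_ ->]]|]; [exact: vdist_ge0|exists a]. Qed.

Lemma dist_set_ge x m : (forall a, Sigma a -> m <= vdist x a) -> m <= dist_set Sigma x.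
Proof.
move=> h; apply: (@Rinf_ge _ _ (vdist x a0)) => [t [y [_ ->]]||u [y [Sy ->]]].
- exact: vdist_ge0.
- by exists a0.
- exact: h.
Qed.

Lemma dist_set_ge0 x : 0 <= dist_set Sigma x.
Proof. by apply: dist_set_ge => a _; exact: vdist_ge0. Qed.

(** An almost nearest point is enough for all estimates and avoids the compactness argument behind a
    nearest one. *)
Lemma dist_set_near x e : 0 < e ->
  exists a, Sigma a /\ vdist x a < dist_set Sigma x + e.
Proof.
move=> e0; apply: NNPP => H; suff: dist_set Sigma x + e <= dist_set Sigma x by lra.
apply: dist_set_ge => a Sa; apply: Rnot_lt_le => h; apply: H; by exists a.
Qed.

Lemma dist_set_lip x y : dist_set Sigma x <= dist_set Sigma y + vdist x y.
Proof.
suff: dist_set Sigma x - vdist x y <= dist_set Sigma y by lra.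
apply: dist_set_ge => a Sa.
by have := vdist_triangle y x a; have := dist_set_le x Sa; lra.
Qed.

Lemma dist_set_gt0 x : rn_closed Sigma -> ~ Sigma x -> 0 < dist_set Sigma x.
Proof.
move=> cl /cl [eta [eta0 h]]; apply: Rlt_le_trans eta0 _.
apply: dist_set_ge => a Sa; apply: Rnot_lt_le; rewrite vdist_sym => /h; exact.
Qed.

Lemma dist_set_eq0 x : Sigma x -> dist_set Sigma x = 0.
Proof. move=> /(dist_set_le x); rewrite vdistxx; have := dist_set_ge0 x; lra. Qed.

End DistSet.

(** * Partial derivatives *)

Lemma fin_choice n (T : Type) (P : 'I_n -> T -> Prop) :
  (forall i, exists y, P i y) -> exists f, forall i, P i (f i).
Proof.
move=> h; exists (fun i => proj1_sig (constructive_indefinite_description _ (h i))).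
by move=> i; case: constructive_indefinite_description.
Qed.

(** The reciprocal of 1 + sum of the 1/d_i lies below every d_i, and it makes sense for an empty
    index set too. *)
Lemma fin_pos_lb n (d : 'I_n -> R) :
  (forall i, 0 < d i) -> exists m, 0 < m /\ forall i, m <= d i.
Proof.
move=> h; set S := sumR (fun i => / d i).
have S0 : 0 <= S.
  by apply: sumR_ge0 => i; apply: Rlt_le; exact: Rinv_0_lt_compat.
exists (/ (1 + S)); split; first by apply: Rinv_0_lt_compat; lra.
move=> i; rewrite -[d i]Rinv_inv; apply: Rinv_le_contravar.
  exact: Rinv_0_lt_compat.
suff: / d i <= S by lra.
apply: (@term_le_sumR n (fun i => / d i)) => j.
by apply: Rlt_le; exact: Rinv_0_lt_compat.
Qed.

(** Asking for [Q] at all smaller values lets the thresholds of the different indices be merged into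
    one. *)
Lemma fin_small n (Q : 'I_n -> R -> Prop) :
  (forall i, exists d, 0 < d /\ forall d', 0 < d' <= d -> Q i d') ->
  exists d, 0 < d /\ forall i d', 0 < d' <= d -> Q i d'.
Proof.
move=> /fin_choice [f hf]; have [|m [m0 hm]] := @fin_pos_lb n f.
  by move=> i; case: (hf i).
by exists m; split=> // i d' hd; apply: (proj2 (hf i)); have := hm i; lra.
Qed.

Lemma fin_large n (Q : 'I_n -> R -> Prop) :
  (forall i, exists K, 0 <= K /\ forall K', K <= K' -> Q i K') ->
  exists K, 0 <= K /\ forall i, Q i K.
Proof.
move=> /fin_choice [f hf]; exists (sumR f); split.
  by apply: sumR_ge0 => i; case: (hf i).
move=> i; apply: (proj2 (hf i)); apply: term_le_sumR => j; by case: (hf j).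
Qed.

Lemma vdist_shift n (x : Rn n) i t : vdist (shift x i t) x <= Rabs t.
Proof.
apply: Rle_trans (vnorm_le_sum _) _; rewrite (sumRD1 _ i) /= sumR_eq0.
  by rewrite /vsub /shift eqxx Rplus_0_r; apply: Req_le; congr Rabs; ring.
move=> j; rewrite /vsub /shift; case: (j == i) => //.
by rewrite (_ : x j + 0 - x j = 0) ?Rabs_R0 //; ring.
Qed.

Lemma rn_ball_open n eps : rn_open (@rn_ball n eps).
Proof.
move=> x hx; rewrite /rn_ball in hx *; exists (eps - vnorm x); split; first lra.
move=> y; have := @vnorm_triangle n x (vsub y x) y.
move=> /(_ (fun i => ltac:(rewrite /vsub; ring))); rewrite /vdist; lra.
Qed.

Lemma has_partial_ext n (U : Rn n -> Prop) F G i x L : rn_open U -> U x ->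
  (forall y, U y -> F y = G y) -> has_partial F i x L -> has_partial G i x L.
Proof.
move=> oU Ux e /is_derive_Reals h; apply/is_derive_Reals.
have [eta [eta0 hU]] := oU _ Ux.
apply: is_derive_ext_loc h; exists (mkposreal _ eta0) => t /= ht; apply: e.
apply: hU; apply: Rle_lt_trans (vdist_shift _ _ _) _.
move: ht; rewrite /ball /= /AbsRing_ball /= /abs /minus /plus /opp /=.
by rewrite Ropp_0 Rplus_0_r.
Qed.

Lemma pd_unique n (F : Rn n -> R) i x L : has_partial F i x L -> pd i F x = L.
Proof.
move=> h; apply: (uniqueness_limite _ 0 _ _ _ h).
by apply: (epsilon_spec (inhabits 0) (has_partial F i x)); exists L.
Qed.

(** Differentiability is not at issue: the two choice predicates are equal, so the chosen values are
    equal even where no partial derivative exists. *)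
Lemma pd_ext n (U : Rn n -> Prop) F G i x : rn_open U -> U x ->
  (forall y, U y -> F y = G y) -> pd i F x = pd i G x.
Proof.
move=> oU Ux e; rewrite /pd; congr epsilon.
apply: functional_extensionality => L; apply: propositional_extensionality.
split; apply: has_partial_ext oU Ux _ => // y Uy; by rewrite e.
Qed.

Lemma pdl_ext n (U : Rn n -> Prop) F G l x : rn_open U -> U x ->
  (forall y, U y -> F y = G y) -> pdl l F x = pdl l G x.
Proof.
move=> oU + e; elim: l x => [|i l ih] x Ux /=; first exact: e.
exact: pd_ext oU Ux ih.
Qed.

Lemma pdl_rcons n l i (F : Rn n -> R) : pdl (rcons l i) F = pdl l (pd i F).
Proof. by rewrite /pdl foldr_rcons. Qed.

Lemma cont_on_ext n (U : Rn n -> Prop) F G : rn_open U ->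
  (forall y, U y -> F y = G y) -> cont_on U F -> cont_on U G.
Proof.
move=> oU e h x Ux eps e0; have [d [d0 hd]] := h x Ux eps e0.
have [d' [d'0 hU]] := oU x Ux.
exists (Rmin d d'); split; first exact: Rmin_pos.
move=> y hy; have h1 := Rmin_l d d'; have h2 := Rmin_r d d'.
by rewrite -!e //; [apply: hd; lra|apply: hU; lra].
Qed.

Lemma Cs_ext n s (U : Rn n -> Prop) F G : rn_open U ->
  (forall y, U y -> F y = G y) -> Cs s U F -> Cs s U G.
Proof.
move=> oU e; case: s => [|s] /=; first exact: cont_on_ext.
move=> [c h]; split; first exact: cont_on_ext c.
move=> i; have [H [h1 h2]] := h i; exists H; split=> // x Ux.
exact: (has_partial_ext oU Ux e (h1 x Ux)).
Qed.

Lemma Cs_cont n s (U : Rn n -> Prop) F : Cs s U F -> cont_on U F.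
Proof. by case: s => [|s] // []. Qed.

(** [Cs] only asserts that some function [G] is the partial derivative; by uniqueness it is [pd] on
    [U], and openness of [U] transfers the smoothness. *)
Lemma Cs_pd n s (U : Rn n -> Prop) F i : rn_open U -> Cs s.+1 U F ->
  (forall x, U x -> has_partial F i x (pd i F x)) /\ Cs s U (pd i F).
Proof.
move=> oU [_ /(_ i) [G [h1 h2]]].
have e x : U x -> G x = pd i F x by move=> Ux; rewrite (pd_unique (h1 x Ux)).
split; last exact: Cs_ext e h2.
by move=> x Ux; rewrite -e //; exact: h1.
Qed.

Lemma Cs_sub n s (U V : Rn n -> Prop) F : (forall x, V x -> U x) ->
  Cs s U F -> Cs s V F.
Proof.
move=> sub; elim: s F => [|s ih] F /=; first by move=> h x /sub; exact: h.
move=> [c h]; split; first by move=> x /sub; exact: c.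
move=> i; have [G [h1 h2]] := h i; exists G; split; last exact: ih.
by move=> x /sub; exact: h1.
Qed.

Lemma Cs_pred n s (U : Rn n -> Prop) F : Cs s.+1 U F -> Cs s U F.
Proof.
elim: s F => [|s ih] F; first by case.
move=> [c h]; split=> // i; have [G [h1 h2]] := h i; exists G; split=> //.
exact: ih.
Qed.

Lemma Cs_le n s s' (U : Rn n -> Prop) F : (s' <= s)%N -> Cs s U F -> Cs s' U F.
Proof.
move=> /subnK <-; elim: (s - s')%N => [|k ih] //.
by rewrite addSn => /Cs_pred.
Qed.

Lemma cont_on_lin n (U : Rn n -> Prop) a b F G : cont_on U F -> cont_on U G ->
  cont_on U (fun x => a * F x + b * G x).
Proof.
move=> hF hG x Ux eps e0; set M := Rabs a + Rabs b + 1.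
have a0 := Rabs_pos a; have b0 := Rabs_pos b.
have M0 : 0 < M by rewrite /M; lra.
have e' : 0 < eps / M by apply: Rdiv_lt_0_compat.
have [d [d0 hd]] := hF x Ux _ e'; have [d' [d'0 hd']] := hG x Ux _ e'.
exists (Rmin d d'); split; first exact: Rmin_pos.
move=> y hy; have h1 := Rmin_l d d'; have h2 := Rmin_r d d'.
have := hd y ltac:(lra); have := hd' y ltac:(lra) => H1 H2.
have -> : a * F y + b * G y - (a * F x + b * G x) =
  a * (F y - F x) + b * (G y - G x) by ring.
apply: Rle_lt_trans (Rabs_triang _ _) _; rewrite !Rabs_mult.
have e1 : eps = M * (eps / M) by field; lra.
have p1 := Rabs_pos (F y - F x); have p2 := Rabs_pos (G y - G x).
rewrite e1; move: (eps / M) H1 H2 e' => q H1 H2 q0; rewrite /M; nra.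
Qed.

Lemma has_partial_lin n a b (F G : Rn n -> R) i x L M :
  has_partial F i x L -> has_partial G i x M ->
  has_partial (fun x => a * F x + b * G x) i x (a * L + b * M).
Proof.
move=> hF hG; exact: (derivable_pt_lim_plus (fun t => a * F (shift x i t))
  (fun t => b * G (shift x i t)) _ _ _ (derivable_pt_lim_scal _ a _ _ hF)
  (derivable_pt_lim_scal _ b _ _ hG)).
Qed.

Lemma Cs_lin n s (U : Rn n -> Prop) a b F G : Cs s U F -> Cs s U G ->
  Cs s U (fun x => a * F x + b * G x).
Proof.
elim: s F G => [|s ih] F G /=; first exact: cont_on_lin.
move=> [c h] [c' h']; split; first exact: cont_on_lin.
move=> i; have [H [h1 h2]] := h i; have [H' [h1' h2']] := h' i.
exists (fun x => a * H x + b * H' x); split; last exact: ih.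
by move=> x Ux; apply: has_partial_lin; [exact: h1|exact: h1'].
Qed.

Lemma pd_lin n s (U : Rn n -> Prop) a b F G i x : rn_open U -> U x ->
  Cs s.+1 U F -> Cs s.+1 U G ->
  pd i (fun x => a * F x + b * G x) x = a * pd i F x + b * pd i G x.
Proof.
move=> oU Ux hF hG; apply: pd_unique; apply: has_partial_lin.
  exact: (proj1 (Cs_pd i oU hF)).
exact: (proj1 (Cs_pd i oU hG)).
Qed.

(** The last index of [l] is the innermost derivative. Peeling it off first makes linearity an
    identity on all of [U], which can then be differentiated further. *)
Lemma pdl_lin n s (U : Rn n -> Prop) a b F G l x : rn_open U -> U x ->
  (size l <= s)%N -> Cs s U F -> Cs s U G ->
  pdl l (fun x => a * F x + b * G x) x = a * pdl l F x + b * pdl l G x.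
Proof.
move=> oU Ux; elim/last_ind: l s F G => [|l i ih] s F G //.
rewrite size_rcons !pdl_rcons; case: s => // s hl hF hG.
have <- := ih s _ _ hl (proj2 (Cs_pd i oU hF)) (proj2 (Cs_pd i oU hG)).
apply: (@pdl_ext n U (pd i (fun z => a * F z + b * G z))
  (fun z => a * pd i F z + b * pd i G z) l x oU Ux) => y Uy.
exact: (pd_lin _ _ _ oU Uy hF hG).
Qed.

(** * Mean value theorem, chain rule and Taylor estimate *)

(** The box with opposite corners [x] and [y], instead of the segment: the mean value formula below
    moves parallel to the axes and leaves the segment. *)
Definition between n (x y z : Rn n) :=
  forall j, Rmin (x j) (y j) <= z j <= Rmax (x j) (y j).

Lemma between_dist n (x y z : Rn n) j : between x y z ->
  Rabs (z j - x j) <= Rabs (y j - x j).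
Proof.
move=> /(_ j); rewrite /Rmin /Rmax; case: Rle_dec => h;
  rewrite /Rabs; case: Rcase_abs; case: Rcase_abs; lra.
Qed.

Lemma between_box n (x y z : Rn n) rho : between x y z ->
  (forall j, Rabs (x j) <= rho) -> (forall j, Rabs (y j) <= rho) ->
  forall j, Rabs (z j) <= rho.
Proof.
move=> h hx hy j; move: (h j) (hx j) (hy j); rewrite /Rmin /Rmax.
case: Rle_dec => ?; rewrite /Rabs; do 3 case: Rcase_abs; lra.
Qed.

Lemma telescope_sumR n (u : nat -> R) :
  sumR (fun i : 'I_n => u i.+1 - u i) = u n - u 0%N.
Proof.
rewrite /sumR; elim: n => [|n ih]; first by rewrite big_ord0; ring.
by rewrite big_ord_recr /= ih; ring.
Qed.

Lemma has_partial_line n (F : Rn n -> R) k z t L :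
  has_partial F k (shift z k t) L -> is_derive (fun s => F (shift z k s)) t L.
Proof.
move=> h; apply/is_derive_Reals => eps e0; have [d hd] := h eps e0.
exists d => u u0 ud; have := hd u u0 ud.
have e s : shift (shift z k t) k s = shift z k (t + s).
  by apply: functional_extensionality => j; rewrite /shift; case: (j == k); ring.
by rewrite !e Rplus_0_l Rplus_0_r.
Qed.

(* [x] is joined to [y] by changing one coordinate at a time. *)
Lemma mean_value n (F : Rn n -> R) (G : 'I_n -> Rn n -> R) x y :
  (forall i z, between x y z -> has_partial F i z (G i z)) ->
  exists xi : 'I_n -> Rn n, (forall i, between x y (xi i)) /\
    F y - F x = sumR (fun i => G i (xi i) * (y i - x i)).
Proof.
move=> h; pose z (k : nat) : Rn n := fun j => if (j < k)%N then y j else x j.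
have bt (i : 'I_n) t : Rmin 0 (y i - x i) <= t <= Rmax 0 (y i - x i) ->
    between x y (shift (z i) i t).
  move=> ht j; rewrite /shift /z; case: (altP (j =P i)) => [->|ne].
    rewrite ltnn; move: ht; rewrite /Rmin /Rmax; do 2 case: Rle_dec; lra.
  rewrite Rplus_0_r; case: ifP => _; rewrite /Rmin /Rmax; case: Rle_dec; lra.
have step (i : 'I_n) : exists w, between x y w /\
    F (z i.+1) - F (z i) = G i w * (y i - x i).
  have [||t [ht e]] := MVT_gen (fun t => F (shift (z i) i t)) 0 (y i - x i)
     (fun t => G i (shift (z i) i t)).
  - by move=> t ht; apply: has_partial_line; apply: h; apply: bt; lra.
  - move=> t ht; apply: derivable_continuous_pt; exists (G i (shift (z i) i t)).
    by apply/is_derive_Reals; apply: has_partial_line; apply: h; exact: bt.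
  exists (shift (z i) i t); split; first exact: bt.
  have -> : z i.+1 = shift (z i) i (y i - x i).
    apply: functional_extensionality => j; rewrite /shift /z ltnS leq_eqVlt.
    case: (altP (j =P i)) => [->|ne] /=; first by rewrite eqxx ltnn /=; ring.
    by rewrite (negbTE ne : (_ == _ :> nat) = false) /= Rplus_0_r.
  rewrite -[y i - x i in RHS]Rminus_0_r -e; congr (_ - F _).
  by apply: functional_extensionality => j; rewrite /shift; case: (j == i); ring.
have [xi hxi] := fin_choice step; exists xi; split; first by move=> i; case: (hxi i).
have <- : F (z n) = F y.
  by congr F; apply: functional_extensionality => j; rewrite /z ltn_ord.
rewrite -[F x]/(F (z 0%N)) -(telescope_sumR n (fun k => F (z k))).
by apply: eq_sumR => i; case: (hxi i).
Qed.

Lemma mean_value_le n (F : Rn n -> R) (G : 'I_n -> Rn n -> R) x y K c :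
  (forall i z, between x y z -> has_partial F i z (G i z)) ->
  (forall i z, between x y z -> Rabs (G i z) <= K) ->
  (forall i, Rabs (y i - x i) <= c) ->
  Rabs (F y - F x) <= INR n * (K * c).
Proof.
move=> /mean_value [xi [hxi ->]] hK hc; apply: Rabs_sumR_le => i.
rewrite Rabs_mult; apply: Rmult_le_compat; try exact: Rabs_pos; by auto.
Qed.

Lemma vdist_le_mono n (x y z : Rn n) :
  (forall j, Rabs (z j - x j) <= Rabs (y j - x j)) -> vdist z x <= vdist y x.
Proof.
move=> h; apply: sqrt_le_1_alt; apply: ler_sumR => i; rewrite /vsub.
by apply: Rsqr_le_abs_1.
Qed.

Lemma curve_cont n (gam : R -> Rn n) (v : Rn n) t eps :
  (forall j, is_derive (fun s => gam s j) t (v j)) -> 0 < eps ->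
  exists d, 0 < d /\ forall s, Rabs (s - t) < d -> vdist (gam s) (gam t) < eps.
Proof.
move=> h e0; have n0 := pos_INR n.
have e' : 0 < eps / (INR n + 1) by apply: Rdiv_lt_0_compat; lra.
have [|d [d0 hd]] := @fin_small n (fun j d =>
  forall s, Rabs (s - t) < d -> Rabs (gam s j - gam t j) < eps / (INR n + 1)).
  move=> j; have /continuity_pt_filterlim c : continuous (fun s => gam s j) t.
    by apply: ex_derive_continuous; exists (v j); exact: h.
  have [d [d0 hd]] := c _ e'; exists d; split=> // d' hd' s hs.
  case: (Req_dec s t) => [->|ne]; first by rewrite Rminus_diag Rabs_R0.
  apply: hd; split; first by split=> //; exact: nesym.
  rewrite /= /R_dist; lra.
exists d; split=> // s hs; have H j : Rabs (gam s j - gam t j) <= eps / (INR n + 1).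
  by apply: Rlt_le; apply: hd hs; lra.
apply: Rle_lt_trans (vdist_le_coord H) _.
have -> : INR n * (eps / (INR n + 1)) = eps - eps / (INR n + 1) by field; lra.
lra.
Qed.

(** By the mean value formula the difference quotient is a sum of partial derivatives, taken at
    points of the box spanned by the two curve points, times difference quotients of the
    coordinates. The box shrinks to [gam t], where the partial derivatives are continuous. *)
Lemma chain_rule n (U : Rn n -> Prop) F (G : 'I_n -> Rn n -> R)
    (gam : R -> Rn n) (v : Rn n) t : rn_open U ->
  (forall i x, U x -> has_partial F i x (G i x)) ->
  (forall i, cont_on U (G i)) ->
  U (gam t) -> (forall j, is_derive (fun s => gam s j) t (v j)) ->
  is_derive (fun s => F (gam s)) t (sumR (fun j => G j (gam t) * v j)).
Proof.
move=> oU hp hc Ut hv; apply/is_derive_Reals => eps e0.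
have n0 := pos_INR n; set e1 := eps / (INR n + 1).
have e10 : 0 < e1 by apply: Rdiv_lt_0_compat; lra.
have [eta [eta0 hU]] := oU _ Ut.
have [dU [dU0 hdU]] := curve_cont hv eta0.
have [|d [d0 hd]] := @fin_small n (fun j d => forall h w, h <> 0 -> Rabs h < d ->
   between (gam t) (gam (t + h)) w ->
   Rabs (G j w * ((gam (t + h) j - gam t j) / h) - G j (gam t) * v j) < e1).
  move=> j; have v0 := Rabs_pos (v j); have G0 := Rabs_pos (G j (gam t)).
  (* The bound 1 turns the quadratic error e2 * e2 into e2; the three errors then add up to less
     than e2 (|v_j| + |G_j| + 2) <= e1. *)
  set e2 := Rmin 1 (e1 / (Rabs (v j) + Rabs (G j (gam t)) + 2)).
  have q0 : 0 < e1 / (Rabs (v j) + Rabs (G j (gam t)) + 2).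
    by apply: Rdiv_lt_0_compat; lra.
  have e20 : 0 < e2 by apply: Rmin_pos => //; lra.
  have e21 : e2 <= 1 by exact: Rmin_l.
  have e22 : e2 * (Rabs (v j) + Rabs (G j (gam t)) + 2) <= e1.
    have := Rmin_r 1 (e1 / (Rabs (v j) + Rabs (G j (gam t)) + 2)); rewrite -/e2.
    move=> H; apply: Rle_trans (Rmult_le_compat_r _ _ _ _ H) _; first lra.
    by apply: Req_le; rewrite /Rdiv Rmult_assoc Rinv_l ?Rmult_1_r //; lra.
  have [z [z0 hz]] := hc j _ Ut _ e20; have [dz [dz0 hdz]] := curve_cont hv z0.
  have /is_derive_Reals hv' := hv j; have [dv hdv] := hv' _ e20.
  exists (Rmin dz dv); split; first by apply: Rmin_pos => //; exact: cond_pos.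
  move=> d' [_ hd'] h w h0 hh bw; have m1 := Rmin_l dz dv; have m2 := Rmin_r dz dv.
  have A : Rabs (G j w - G j (gam t)) < e2.
    apply: hz; apply: Rle_lt_trans (hdz (t + h) _).
      by apply: vdist_le_mono => k; exact: between_dist.
    have -> : t + h - t = h by ring.
    lra.
  have B : Rabs ((gam (t + h) j - gam t j) / h - v j) < e2 by apply: hdv => //; lra.
  move: (_ / h) B => q B.
  have -> : G j w * q - G j (gam t) * v j =
     (G j w - G j (gam t)) * (q - v j) + (G j w - G j (gam t)) * v j
       + G j (gam t) * (q - v j) by ring.
  apply: Rle_lt_trans (Rabs_triang _ _) _.
  apply: Rle_lt_trans (Rplus_le_compat_r _ _ _ (Rabs_triang _ _)) _.
  rewrite !Rabs_mult; have p1 := Rabs_pos (G j w - G j (gam t)).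
  have p2 := Rabs_pos (q - v j); nra.
have m0 : 0 < Rmin d dU by exact: Rmin_pos.
exists (mkposreal _ m0) => h h0 /= hh; have m1 := Rmin_l d dU; have m2 := Rmin_r d dU.
have Th : t + h - t = h by ring.
have [|xi [bxi ->]] := @mean_value n F G (gam t) (gam (t + h)).
  move=> i w bw; apply: hp; apply: hU.
  apply: Rle_lt_trans (hdU (t + h) _); last by rewrite Th; lra.
  by apply: vdist_le_mono => k; exact: between_dist.
have -> : sumR (fun i => G i (xi i) * (gam (t + h) i - gam t i)) / h -
   sumR (fun j => G j (gam t) * v j) =
   sumR (fun i => G i (xi i) * ((gam (t + h) i - gam t i) / h) - G i (gam t) * v i).
  rewrite sumRB; congr (_ - _); rewrite Rdiv_def Rmult_comm -sumRZ.
  by apply: eq_sumR => i; field.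
have H i : Rabs (G i (xi i) * ((gam (t + h) i - gam t i) / h) - G i (gam t) * v i) <= e1.
  by apply: Rlt_le; apply: (hd i d) => //; lra.
apply: Rle_lt_trans (Rabs_sumR_le H) _.
have -> : INR n * e1 = eps - e1 by rewrite /e1; field; lra.
lra.
Qed.

Lemma box_ball n (x : Rn n) eps : 0 < eps ->
  (forall j, Rabs (x j) <= eps / (INR n + 1)) -> rn_ball eps x.
Proof.
move=> e0 /vnorm_le_coord h; have n0 := pos_INR n.
have -> : eps = INR n * (eps / (INR n + 1)) + eps / (INR n + 1) by field; lra.
have e1 : 0 < eps / (INR n + 1) by apply: Rdiv_lt_0_compat; lra.
rewrite /rn_ball; lra.
Qed.

Lemma near0_bounded n eps (F : Rn n -> R) : 0 < eps -> cont_on (rn_ball eps) F ->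
  exists K, 0 <= K /\ exists rho, 0 < rho /\
    forall x, (forall j, Rabs (x j) <= rho) -> Rabs (F x) <= K.
Proof.
move=> e0 /(_ (@vzero n)) h; have n0 := pos_INR n.
have [|eta [eta0 he]] := h _ 1 Rlt_0_1.
  rewrite /rn_ball -vdistx0 vdistxx //.
exists (Rabs (F (@vzero n)) + 1); split; first by have := Rabs_pos (F (@vzero n)); lra.
exists (eta / (INR n + 1)); split; first by apply: Rdiv_lt_0_compat; lra.
move=> x /(box_ball eta0) hx; have := he x; rewrite vdistx0 => /(_ hx) H.
have := Rabs_triang (F x - F (@vzero n)) (F (@vzero n)).
have -> : F x - F (@vzero n) + F (@vzero n) = F x by ring.
lra.
Qed.

(* The assertions [P K rho] below are estimates with constant [K] on a
   neighbourhood of [0] of size [rho]. *)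
Definition large_small (P : R -> R -> Prop) :=
  exists K rho, 0 <= K /\ 0 < rho /\
    forall K' rho', K <= K' -> 0 < rho' <= rho -> P K' rho'.

Lemma large_small_fin n (P : 'I_n -> R -> R -> Prop) :
  (forall i, large_small (P i)) -> large_small (fun K rho => forall i, P i K rho).
Proof.
move=> /fin_choice [K /fin_choice [rho h]].
have [|m [m0 hm]] := @fin_pos_lb n rho; first by move=> i; case: (h i) => _ [].
exists (sumR K), m; split; first by apply: sumR_ge0 => i; case: (h i).
split=> // K' rho' hK hr i; have [_ [_ H]] := h i.
apply: H; last by have := hm i; lra.
by apply: Rle_trans hK; apply: term_le_sumR => j; case: (h j).
Qed.

Lemma large_small_and (P Q : R -> R -> Prop) :
  large_small P -> large_small Q -> large_small (fun K rho => P K rho /\ Q K rho).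
Proof.
move=> [K [m [K0 [m0 h]]]] [K' [m' [K'0 [m'0 h']]]].
exists (K + K'), (Rmin m m'); split; first lra.
split; first exact: Rmin_pos.
move=> A b hA hb; have := Rmin_l m m'; have := Rmin_r m m' => h1 h2.
by split; [apply: h|apply: h']; lra.
Qed.

Lemma large_small_imp (P Q : R -> R -> Prop) :
  (forall K rho, 0 <= K -> 0 < rho -> P K rho -> Q K rho) ->
  large_small P -> large_small Q.
Proof.
move=> h [K [m [K0 [m0 H]]]]; exists K, m; split=> //; split=> // K' m' hK hm.
by apply: h; [lra|lra|exact: H].
Qed.

Definition in_box n (rho : R) (x : Rn n) := forall j, Rabs (x j) <= rho.

(** No Taylor polynomial appears: two functions with equal jets are compared. By induction the
    partial derivatives of F - G are at most K c^m between [a] and [x], and the mean value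
    inequality contributes one more factor c. The constants do not depend on the base point [a],
    which will vary along [Sigma]. *)
Lemma taylor n m eps (F G : Rn n -> R) : 0 < eps ->
  Cs m (rn_ball eps) F -> Cs m (rn_ball eps) G ->
  large_small (fun K rho => forall a x c, in_box rho a -> in_box rho x ->
    (forall l, (size l < m)%N -> pdl l F a = pdl l G a) ->
    (forall j, Rabs (x j - a j) <= c) -> 0 <= c -> Rabs (F x - G x) <= K * c ^ m).
Proof.
move=> e0; elim: m F G => [|m ih] F G hF hG.
  have [K [K0 [rho [rho0 h]]]] := near0_bounded e0 (cont_on_lin 1 (-1) hF hG).
  exists K, rho; split=> //; split=> // K' rho' hK hr a x c ha hx _ _ _ /=.
  rewrite Rmult_1_r; apply: Rle_trans hK; apply: Rle_trans (h x _).
    by apply: Req_le; congr Rabs; ring.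
  by move=> j; have := hx j; lra.
have ob := @rn_ball_open n eps.
have H i := ih _ _ (proj2 (Cs_pd i ob hF)) (proj2 (Cs_pd i ob hG)).
have [K [rho [K0 [rho0 {}H]]]] := large_small_fin H.
have n0 := pos_INR n.
have q0 : 0 < eps / (INR n + 1) by apply: Rdiv_lt_0_compat; lra.
(* A box of half-width eps / (n + 1) lies inside the ball of radius eps, where the partial
   derivatives exist. *)
exists (INR n * K), (Rmin rho (eps / (INR n + 1))); split; first nra.
split; first exact: Rmin_pos.
move=> K' rho' hK hr a x c ha hx hl hc c0.
have m1 := Rmin_l rho (eps / (INR n + 1)); have m2 := Rmin_r rho (eps / (INR n + 1)).
have Ea : F a = G a by have := hl [::] isT.
have inb z : between a x z -> rn_ball eps z.
  move=> bz; apply: box_ball => // j; have := between_box bz ha hx j; lra.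
have := @mean_value_le n (fun x => 1 * F x + (-1) * G x)
  (fun i x => 1 * pd i F x + (-1) * pd i G x) a x (K * c ^ m) c.
have -> : 1 * F x + -1 * G x - (1 * F a + -1 * G a) = F x - G x by rewrite Ea; ring.
move=> /(_ _ _ hc) M; apply: Rle_trans (M _ _) _.
- move=> i z bz; apply: has_partial_lin.
    by apply: (proj1 (Cs_pd i ob hF)); exact: inb.
  by apply: (proj1 (Cs_pd i ob hG)); exact: inb.
- move=> i z bz; have -> : 1 * pd i F z + -1 * pd i G z = pd i F z - pd i G z by ring.
  apply: (H K rho' _ _ i a z) => //.
  + exact: Rle_refl.
  + lra.
  + exact: between_box bz ha hx.
  + by move=> l hl'; rewrite -!pdl_rcons; apply: hl; rewrite size_rcons.
  + by move=> j; apply: Rle_trans (between_dist j bz) _.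
- have cm : 0 <= c * c ^ m by exact: (pow_le c m.+1).
  have -> : INR n * (K * c ^ m * c) = INR n * K * (c * c ^ m) by ring.
  by rewrite /=; apply: Rmult_le_compat_r.
Qed.

Lemma lipschitz_near0 n eps (F : Rn n -> R) : 0 < eps -> Cs 1 (rn_ball eps) F ->
  large_small (fun K rho => forall x y c, in_box rho x -> in_box rho y ->
    (forall j, Rabs (x j - y j) <= c) -> 0 <= c ->
    Rabs (F x) <= K /\ Rabs (F x - F y) <= K * c).
Proof.
move=> e0 hF; have ob := @rn_ball_open n eps; have n0 := pos_INR n.
have [K0 [K00 [r0 [r00 B0]]]] := near0_bounded e0 (Cs_cont hF).
have H i : large_small (fun K rho => forall x, in_box rho x -> Rabs (pd i F x) <= K).
  have [K1 [K10 [r1 [r10 B1]]]] := near0_bounded e0 (proj2 (Cs_pd i ob hF)).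
  exists K1, r1; split=> //; split=> // K' r' hK hr x hx; apply: Rle_trans hK.
  by apply: B1 => j; have := hx j; lra.
have [K [r1 [K1 [r10 {}H]]]] := large_small_fin H.
have q0 : 0 < eps / (INR n + 1) by apply: Rdiv_lt_0_compat; lra.
exists (K0 + INR n * K), (Rmin (Rmin r0 r1) (eps / (INR n + 1))); split; first nra.
split; first by apply: Rmin_pos => //; exact: Rmin_pos.
move=> K' r hK hr x y c hx hy hc c0.
have m1 := Rmin_l (Rmin r0 r1) (eps / (INR n + 1)).
have m2 := Rmin_r (Rmin r0 r1) (eps / (INR n + 1)).
have m3 := Rmin_l r0 r1; have m4 := Rmin_r r0 r1.
have nK : 0 <= INR n * K by nra.
split.
  by apply: Rle_trans (B0 x _) _ => [j|]; [have := hx j; lra|lra].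
have := @mean_value_le n F (fun i => pd i F) y x K c => M.
apply: Rle_trans (M _ _ hc) _; last by rewrite -Rmult_assoc; apply: Rmult_le_compat_r; lra.
  move=> i z bz; apply: (proj1 (Cs_pd i ob hF)); apply: box_ball => // j.
  by have := between_box bz hy hx j; lra.
move=> i z bz; apply: (H K r1) => // [||j]; [lra|lra|].
by have := between_box bz hy hx j; lra.
Qed.

(** * Real induction and Gronwall's inequality *)

(** The supremum of the times up to which [Q] holds is attained by the closure step and equals 1 by
    the opening step. This replaces compactness of [0,1], both for the life span of trajectories and
    for constants uniform in t. *)
Lemma real_induction (Q : R -> Prop) : Q 0 ->
  (forall t, 0 <= t <= 1 -> Q t ->
     exists d, 0 < d /\ forall s, t <= s < t + d -> Q s) ->
  (forall T, 0 < T <= 1 -> (forall s, 0 <= s < T -> Q s) -> Q T) ->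
  forall t, 0 <= t <= 1 -> Q t.
Proof.
move=> Q0 op cl; pose E t := 0 <= t <= 1 /\ forall s, 0 <= s <= t -> Q s.
have E0 : E 0 by split; [lra|move=> s hs; have -> : s = 0 by lra].
have [||m [ub lb]] := completeness E.
- by exists 1 => t [ht _]; lra.
- by exists 0.
have m0 : 0 <= m by exact: ub.
have m1 : m <= 1 by apply: lb => t [ht _]; lra.
have below s : 0 <= s < m -> Q s.
  move=> hs; apply: NNPP => nQ; suff: m <= s by lra.
  apply: lb => t [ht hQ]; apply: Rnot_lt_le => st; apply: nQ; apply: hQ; lra.
have Qm : Q m.
  case: (Req_dec m 0) => [->//|ne]; apply: cl => //; lra.
have Em s : 0 <= s <= m -> Q s.
  by move=> hs; case: (Req_dec s m) => [->//|ne]; apply: below; lra.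
have [|d [d0 hd]] := op m _ Qm; first lra.
case: (Rlt_dec m 1) => [lt|ge]; last by move=> t ht; apply: Em; lra.
have m2 := Rmin_l 1 (m + d / 2); have m3 := Rmin_r 1 (m + d / 2).
have : E (Rmin 1 (m + d / 2)).
  split; first by split=> //; apply: Rmin_glb; lra.
  move=> s hs; case: (Rle_dec s m) => h; first by apply: Em; lra.
  by apply: hd; lra.
move=> /ub; rewrite /Rmin; case: Rle_dec; lra.
Qed.

(** The functions g + u and g - u are nondecreasing. The bound is asked for in the open interval
    only, so the lemma can serve to establish a property at the end time [T] that is known just
    before it. *)
Lemma derive_abs_le (u g du dg : R -> R) T : 0 <= T ->
  (forall s, 0 <= s <= T -> is_derive u s (du s)) ->
  (forall s, 0 <= s <= T -> is_derive g s (dg s)) ->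
  (forall s, 0 < s < T -> Rabs (du s) <= dg s) ->
  Rabs (u T - u 0) <= g T - g 0.
Proof.
move=> T0 hu hg h; case: (Req_dec T 0) => [->|ne].
  by rewrite !Rminus_diag Rabs_R0; lra.
have Tp : 0 < T by lra.
apply: Rabs_le; split.
  have [s0 hs0|s [e hs]] := MVT_cor2 (fun s => g s + u s) (fun s => dg s + du s) 0 T Tp.
    by apply/is_derive_Reals; apply: (is_derive_plus g u); auto.
  have /Rabs_le_between := h s hs => H.
  have : 0 <= (dg s + du s) * (T - 0) by apply: Rmult_le_pos; lra.
  by lra.
have [s0 hs0|s [e hs]] := MVT_cor2 (fun s => g s - u s) (fun s => dg s - du s) 0 T Tp.
  by apply/is_derive_Reals; apply: (is_derive_minus g u); auto.
have /Rabs_le_between := h s hs => H.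
have : 0 <= (dg s - du s) * (T - 0) by apply: Rmult_le_pos; lra.
by lra.
Qed.

Lemma is_derive_expmul k s : is_derive (fun s => exp (k * s)) s (k * exp (k * s)).
Proof. by auto_derive => //; ring. Qed.

(** exp(-c s) u(s) does not increase and exp(c s) u(s) does not decrease. The second, backward
    inequality is what later keeps trajectories away from [Sigma]. *)
Lemma gronwall (u du : R -> R) T c : 0 <= T ->
  (forall s, 0 <= s <= T -> is_derive u s (du s)) ->
  (forall s, 0 < s < T -> Rabs (du s) <= c * u s) ->
  u T <= exp (c * T) * u 0 /\ u 0 <= exp (c * T) * u T.
Proof.
move=> T0 hu h; case: (Req_dec T 0) => [->|ne].
  by rewrite Rmult_0_r exp_0 Rmult_1_l; split; exact: Rle_refl.
have Tp : 0 < T by lra.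
have D k s : 0 <= s <= T ->
    is_derive (fun s => exp (k * s) * u s) s (exp (k * s) * (k * u s + du s)).
  move=> hs; have := is_derive_mult (fun s => exp (k * s)) u s _ _
    (is_derive_expmul k s) (hu s hs) Rmult_comm.
  congr (is_derive _ _ _); rewrite /plus /mult /=; ring.
have key : exp (- c * T) * u T - exp (- c * 0) * u 0 <= 0.
  have [s0 hs0|s [-> hs]] := MVT_cor2 (fun s => exp (- c * s) * u s)
      (fun s => exp (- c * s) * (- c * u s + du s)) 0 T Tp.
    by apply/is_derive_Reals; exact: D.
  have /Rabs_le_between H := h s hs; have e0 := exp_pos (- c * s).
  have : 0 <= exp (- c * s) * (- (- c * u s + du s)) * T.
    by apply: Rmult_le_pos; [apply: Rmult_le_pos; lra|lra].
  lra.
have key2 : 0 <= exp (c * T) * u T - exp (c * 0) * u 0.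
  have [s0 hs0|s [-> hs]] := MVT_cor2 (fun s => exp (c * s) * u s)
      (fun s => exp (c * s) * (c * u s + du s)) 0 T Tp.
    by apply/is_derive_Reals; exact: D.
  have /Rabs_le_between H := h s hs; have e0 := exp_pos (c * s).
  by apply: Rmult_le_pos; [apply: Rmult_le_pos; lra|lra].
rewrite Rmult_0_r exp_0 Rmult_1_l in key2; split; last lra.
rewrite Rmult_0_r exp_0 Rmult_1_l in key.
have e0 := exp_pos (c * T).
have e1 : exp (c * T) * exp (- c * T) = 1.
  by rewrite -exp_plus (_ : c * T + - c * T = 0) ?exp_0 //; ring.
have : exp (c * T) * (exp (- c * T) * u T) <= exp (c * T) * u 0.
  by apply: Rmult_le_compat_l; lra.
by rewrite -Rmult_assoc e1 Rmult_1_l.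
Qed.

Lemma is_derive_sumR n (f : 'I_n -> R -> R) (df : 'I_n -> R) t :
  (forall i, is_derive (f i) t (df i)) ->
  is_derive (fun s => sumR (fun i => f i s)) t (sumR df).
Proof.
elim: n f df => [|n ih] f df h.
  rewrite /sumR big_ord0; apply: (is_derive_ext (fun _ => 0)); last exact: is_derive_const.
  by move=> s; rewrite big_ord0.
rewrite /sumR big_ord_recl.
apply: (is_derive_ext (fun s => f ord0 s + sumR (fun i => f (lift ord0 i) s))).
  by move=> s; rewrite /sumR big_ord_recl.
apply: (is_derive_plus (f ord0)); first exact: h.
exact: ih.
Qed.

(** Gronwall is applied to the squared distance, since the distance need not be differentiable where
    the curves meet. The factor n comes from adding coordinate bounds, and [T <= 1] removes [T] from
    the exponent. *)
Lemma curve_gronwall n (gam sig v w : R -> Rn n) L T : 0 <= L -> 0 <= T <= 1 ->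
  (forall s j, 0 <= s <= T -> is_derive (fun s => gam s j) s (v s j)) ->
  (forall s j, 0 <= s <= T -> is_derive (fun s => sig s j) s (w s j)) ->
  (forall s j, 0 < s < T -> Rabs (v s j - w s j) <= L * vdist (gam s) (sig s)) ->
  vdist (gam T) (sig T) <= exp (INR n * L) * vdist (gam 0) (sig 0) /\
  vdist (gam 0) (sig 0) <= exp (INR n * L) * vdist (gam T) (sig T).
Proof.
move=> L0 hT hg hs h; have n0 := pos_INR n.
have Q x y : vdist x y * vdist x y = sumR (fun j : 'I_n => (x j - y j) * (x j - y j)).
  exact: vnorm_sqr.
have [|s hs'|s hs'|G1 G2] := @gronwall (fun s => vdist (gam s) (sig s) * vdist (gam s) (sig s))
  (fun s => sumR (fun j => 2 * ((gam s j - sig s j) * (v s j - w s j)))) T (2 * (INR n * L)).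
- lra.
- apply: (is_derive_ext (fun s => sumR (fun j => (gam s j - sig s j) * (gam s j - sig s j)))).
    by move=> t; rewrite Q.
  apply: (is_derive_sumR (f := fun j s => (gam s j - sig s j) * (gam s j - sig s j))) => j.
  have D := is_derive_minus _ _ _ _ _ (hg s j hs') (hs s j hs').
  have := is_derive_mult _ _ s _ _ D D Rmult_comm.
  congr (is_derive _ _ _); rewrite /plus /mult /minus /plus /opp /=; ring.
- have d0 := vdist_ge0 (gam s) (sig s).
  have -> : 2 * (INR n * L) * (vdist (gam s) (sig s) * vdist (gam s) (sig s)) =
     INR n * (2 * (vdist (gam s) (sig s) * (L * vdist (gam s) (sig s)))) by ring.
  apply: Rabs_sumR_le => j; rewrite !Rabs_mult (Rabs_pos_eq 2); last lra.
  apply: Rmult_le_compat_l; first lra.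
  apply: Rmult_le_compat; try exact: Rabs_pos; first exact: coord_le_vdist.
  exact: h.
have X : exp (2 * (INR n * L) * T) = exp (INR n * L * T) * exp (INR n * L * T).
  by rewrite -exp_plus; congr exp; ring.
have le : exp (INR n * L * T) <= exp (INR n * L).
  have nL : 0 <= INR n * L by nra.
  case: (Req_dec (INR n * L * T) (INR n * L)) => [->|ne]; first exact: Rle_refl.
  by apply: Rlt_le; apply: exp_increasing; nra.
have e0 := exp_pos (INR n * L * T).
have dT := vdist_ge0 (gam T) (sig T); have d0 := vdist_ge0 (gam 0) (sig 0).
rewrite {}X in G1 G2; clear Q h hg hs.
move: (exp (INR n * L * T)) (exp (INR n * L)) (vdist (gam T) (sig T))
  (vdist (gam 0) (sig 0)) G1 G2 le e0 dT d0.
move=> e E a b G1 G2 le e0 a0 b0.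
have sq u z : 0 <= z -> u * u <= z * z -> u <= z by nra.
split.
  apply: Rle_trans (sq a (e * b) _ _) _; [nra|nra|nra].
apply: Rle_trans (sq b (e * a) _ _) _; [nra|nra|nra].
Qed.

(** * The Picard-Lindeloef theorem *)

Lemma le_geom a b c : (forall k, a <= b + c * (/ 2) ^ k) -> a <= b.
Proof.
move=> h; apply: Rnot_lt_le => lt.
have c0 : 0 < Rabs c + 1 by have := Rabs_pos c; lra.
have e0 : 0 < (a - b) / (Rabs c + 1) by apply: Rdiv_lt_0_compat; lra.
have [|N hN] := pow_lt_1_zero (/ 2) _ _ e0; first by rewrite Rabs_pos_eq; lra.
have := hN N (Nat.le_refl N); have := h N.
have p0 : 0 < (/ 2) ^ N by apply: pow_lt; lra.
rewrite Rabs_pos_eq; last lra; move=> H1 H2.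
have : (/ 2) ^ N * (Rabs c + 1) < a - b.
  have := Rmult_lt_compat_r _ _ _ c0 H2.
  by rewrite /Rdiv Rmult_assoc Rinv_l ?Rmult_1_r //; lra.
have := Rle_abs c; nra.
Qed.

Lemma geom_cauchy_limit (u : nat -> R) M : 0 <= M ->
  (forall k, Rabs (u k.+1 - u k) <= M * (/ 2) ^ k) ->
  exists l, forall k, Rabs (l - u k) <= 2 * M * (/ 2) ^ k.
Proof.
move=> M0 h; have p0 k : 0 < (/ 2) ^ k by apply: pow_lt; lra.
(* The subtracted tail closes the induction: one step costs M / 2^(k+m), which is exactly the
   decrease of the tail. *)
have D k m : Rabs (u (k + m)%N - u k) <= 2 * M * (/ 2) ^ k - 2 * M * (/ 2) ^ (k + m)%N.
  elim: m => [|m ih]; first by rewrite addn0 !Rminus_diag Rabs_R0; exact: Rle_refl.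
  rewrite addnS; have -> : u (k + m).+1 - u k =
    (u (k + m).+1 - u (k + m)%N) + (u (k + m)%N - u k) by ring.
  apply: Rle_trans (Rabs_triang _ _) _; have := h (k + m)%N; rewrite /=; lra.
have D' k m : Rabs (u (k + m)%N - u k) <= 2 * M * (/ 2) ^ k.
  by have := D k m; have := p0 (k + m)%N; nra.
have [|l hl] := Rcomplete.R_complete u.
  move=> eps e0.
  have c0 : 0 < 4 * M + 1 by lra.
  have e1 : 0 < eps / (4 * M + 1) by apply: Rdiv_lt_0_compat.
  have [|N hN] := pow_lt_1_zero (/ 2) _ _ e1; first by rewrite Rabs_pos_eq; lra.
  have := hN N (Nat.le_refl N); rewrite Rabs_pos_eq; last by have := p0 N; lra.
  move=> H; have H' : (/ 2) ^ N * (4 * M + 1) < eps.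
    have := Rmult_lt_compat_r _ _ _ c0 H.
    by rewrite /Rdiv Rmult_assoc Rinv_l ?Rmult_1_r //; lra.
  exists N => a b /leP ha /leP hb; rewrite /R_dist.
  rewrite -(subnKC ha) -(subnKC hb).
  have := D' N (a - N)%N; have := D' N (b - N)%N => H1 H2.
  set A := u (N + (a - N))%N in H2 *; set B := u (N + (b - N))%N in H1 *.
  have -> : A - B = (A - u N) - (B - u N) by ring.
  apply: Rle_lt_trans (Rabs_triang _ _) _; rewrite Rabs_Ropp.
  by have := p0 N; nra.
exists l => k; apply: Rnot_lt_le => lt.
have [N hN] := hl _ (Rlt_Rminus _ _ lt).
have := hN (k + N)%N; rewrite /R_dist => /(_ ltac:(apply/leP; exact: leq_addl)) H.
have := D' k N => H'.
have := Rabs_triang (u (k + N)%N - u k) (- (u (k + N)%N - l)).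
rewrite Rabs_Ropp; have -> : u (k + N)%N - u k + - (u (k + N)%N - l) = l - u k by ring.
lra.
Qed.

Section Picard.
Variables (n : nat) (V : R -> Rn n -> Rn n) (L B : R) (x0 : Rn n).
Hypothesis L1 : 1 <= L.
Hypothesis B0 : 0 <= B.
Hypothesis VL : forall t s x y c i, Rabs (t - s) <= c ->
  (forall j, Rabs (x j - y j) <= c) -> Rabs (V t x i - V s y i) <= L * c.
Hypothesis VB : forall t x i, Rabs (V t x i) <= B.

Let lipc (gam : R -> Rn n) := forall s t j, 0 <= s -> 0 <= t ->
  Rabs (gam s j - gam t j) <= B * Rabs (s - t).

(* The curve is frozen for negative times, so that the primitive is
   differentiable on both sides of [0]. *)
Let field (gam : R -> Rn n) i s := V s (gam (Rmax 0 s)) i.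
Let step (gam : R -> Rn n) : R -> Rn n := fun t i => x0 i + RInt (field gam i) 0 t.

Lemma picard_field_continuous gam i s : lipc gam -> continuous (field gam i) s.
Proof.
move=> h; apply/continuity_pt_filterlim => eps e0.
have c0 : 0 < L * (B + 1) by nra.
have d0 : 0 < eps / (L * (B + 1)) by apply: Rdiv_lt_0_compat.
exists (eps / (L * (B + 1))); split=> // t [_]; rewrite /= /R_dist => ht.
apply: Rle_lt_trans (VL (c := (B + 1) * Rabs (t - s)) _ _ _) _.
- by have := Rabs_pos (t - s); nra.
- move=> j; apply: Rle_trans (h _ _ _ (Rmax_l _ _) (Rmax_l _ _)) _.
  have : Rabs (Rmax 0 t - Rmax 0 s) <= Rabs (t - s).
    have := Rle_abs (t - s); have := Rle_abs (- (t - s)); rewrite Rabs_Ropp => ? ?.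
    by apply: Rabs_le; rewrite /Rmax; case: Rle_dec; case: Rle_dec; lra.
  by have := Rabs_pos (t - s); nra.
have := Rmult_lt_compat_l _ _ _ c0 ht.
have -> : L * (B + 1) * (eps / (L * (B + 1))) = eps.
  by rewrite /Rdiv Rmult_comm Rmult_assoc Rinv_l ?Rmult_1_r //; lra.
by rewrite Rmult_assoc.
Qed.

Lemma picard_step_derive gam i t : lipc gam ->
  is_derive (fun s => step gam s i) t (field gam i t).
Proof.
move=> h; rewrite /step.
have -> : field gam i t = 0 + field gam i t by ring.
apply: (is_derive_plus (fun _ => x0 i)); first exact: is_derive_const.
apply: (is_derive_RInt (field gam i) _ 0); last exact: picard_field_continuous.
exists (mkposreal _ Rlt_0_1) => s _; apply: RInt_correct.
by apply: ex_RInt_continuous => z _; exact: picard_field_continuous.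
Qed.

Lemma picard_step0 gam i : step gam 0 i = x0 i.
Proof. by rewrite /step RInt_point /zero /=; ring. Qed.

Lemma picard_step_lip gam : lipc gam -> lipc (step gam).
Proof.
move=> h s t j s0 t0.
have [c [hc ->]] := MVT_gen (fun s => step gam s j) t s (field gam j)
  (fun s _ => picard_step_derive j s h)
  (fun s _ => derivable_continuous_pt _ _
     (exist _ _ (proj1 (is_derive_Reals _ _ _) (picard_step_derive j s h)))).
rewrite Rabs_mult; apply: Rmult_le_compat_r; [exact: Rabs_pos|exact: VB].
Qed.

(** In the norm weighted by exp(-2 L t) the Picard operator contracts by 1/2 on the whole half-line,
    so no short time intervals have to be glued. *)
Lemma picard_step_contr gam sig M : lipc gam -> lipc sig ->
  (forall t j, 0 <= t -> Rabs (gam t j - sig t j) <= M * exp (2 * L * t)) ->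
  forall t j, 0 <= t -> Rabs (step gam t j - step sig t j) <= M / 2 * exp (2 * L * t).
Proof.
move=> hg hs h t j t0.
have M0 : 0 <= M.
  have := h 0 j (Rle_refl 0); rewrite Rmult_0_r exp_0 Rmult_1_r.
  by have := Rabs_pos (gam 0 j - sig 0 j); lra.
have := @derive_abs_le (fun t => step gam t j - step sig t j)
  (fun t => M / 2 * exp (2 * L * t)) (fun t => field gam j t - field sig j t)
  (fun t => M / 2 * (2 * L * exp (2 * L * t))) t t0.
rewrite !picard_step0 Rminus_diag Rminus_0_r Rmult_0_r exp_0 => H.
apply: Rle_trans (H _ _ _) _; last lra.
- by move=> s _; apply: (is_derive_minus (fun s => step gam s j));
    exact: picard_step_derive.
- move=> s _; apply: is_derive_scal; exact: is_derive_expmul.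
- move=> s hs'; rewrite /field Rmax_right; last lra.
  have -> : M / 2 * (2 * L * exp (2 * L * s)) = L * (M * exp (2 * L * s)) by field.
  apply: VL; last by move=> k; apply: h; lra.
  rewrite Rminus_diag Rabs_R0; apply: Rmult_le_pos => //; apply: Rlt_le; exact: exp_pos.
Qed.

Let iterate k := iter k step (fun _ => x0).

Lemma picard_iterate_lip k : lipc (iterate k).
Proof.
elim: k => [|k ih]; last exact: picard_step_lip.
move=> s t j _ _ /=; rewrite Rminus_diag Rabs_R0; apply: Rmult_le_pos => //; exact: Rabs_pos.
Qed.

Lemma picard_iterate_diff k t j : 0 <= t ->
  Rabs (iterate k.+1 t j - iterate k t j) <= B * exp (2 * L * t) * (/ 2) ^ k.
Proof.
have H : forall t j, 0 <= t -> Rabs (iterate k.+1 t j - iterate k t j) <=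
    (B * (/ 2) ^ k) * exp (2 * L * t).
  elim: k => [|k ih] {}t {}j t0.
    rewrite /= Rmult_1_r -(picard_step0 (fun _ => x0) j).
    apply: Rle_trans (picard_step_lip (@picard_iterate_lip 0) j t0 (Rle_refl 0)) _.
    rewrite Rminus_0_r Rabs_pos_eq //; apply: Rmult_le_compat_l => //.
    (* This is where [1 <= L] enters: t <= 1 + 2 L t <= exp(2 L t). *)
    have := exp_ineq1_le (2 * L * t); nra.
  have -> : B * (/ 2) ^ k.+1 = (B * (/ 2) ^ k) / 2 by rewrite /=; field.
  exact: picard_step_contr (picard_iterate_lip _) (picard_iterate_lip _) ih _ _ t0.
by move=> t0; apply: Rle_trans (H t j t0) _; apply: Req_le; ring.
Qed.

Theorem picard : exists gam : R -> Rn n, gam 0 = x0 /\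
  forall t i, 0 <= t -> is_derive (fun s => gam s i) t (V t (gam t) i).
Proof.
have lim t : exists y : Rn n, forall j, 0 <= t -> forall k,
    Rabs (y j - iterate k t j) <= 2 * (B * exp (2 * L * t)) * (/ 2) ^ k.
  apply: (@fin_choice n R (fun j y => 0 <= t -> forall k,
    Rabs (y - iterate k t j) <= 2 * (B * exp (2 * L * t)) * (/ 2) ^ k)) => j.
  case: (Rle_dec 0 t) => t0; last by exists 0.
  have [|l hl] := @geom_cauchy_limit (fun k => iterate k t j) (B * exp (2 * L * t)) _
    (fun k => picard_iterate_diff k j t0); last by exists l.
  by apply: Rmult_le_pos => //; apply: Rlt_le; exact: exp_pos.
pose g t := proj1_sig (constructive_indefinite_description _ (lim t)).
have hg t j k : 0 <= t -> Rabs (g t j - iterate k t j) <=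
    2 * (B * exp (2 * L * t)) * (/ 2) ^ k.
  by rewrite /g; case: constructive_indefinite_description => y hy /= t0; exact: hy.
(* The limit inherits the common Lipschitz constant [B] of the iterates, so [step g] has a
   continuous integrand. *)
have lg : lipc g.
  move=> s t j s0 t0.
  apply: (@le_geom _ _ (2 * (B * exp (2 * L * s)) + 2 * (B * exp (2 * L * t)))) => k.
  have := picard_iterate_lip k j s0 t0; have := hg s j k s0; have := hg t j k t0.
  set a := iterate k s j; set b := iterate k t j => h1 h2 h3.
  have -> : g s j - g t j = (g s j - a) + ((a - b) - (g t j - b)) by ring.
  apply: Rle_trans (Rabs_triang _ _) _.
  apply: Rle_trans (Rplus_le_compat_l _ _ _ (Rabs_triang _ _)) _.
  rewrite Rabs_Ropp; lra.
have fix_g t j : 0 <= t -> step g t j = g t j.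
  move=> t0; have e0 := exp_pos (2 * L * t).
  suff : Rabs (step g t j - g t j) <= 0.
    move=> h; have := Rabs_pos (step g t j - g t j) => h'.
    by have := @Rabs_eq_0 (step g t j - g t j); lra.
  apply: (@le_geom _ _ (2 * (B * exp (2 * L * t)))) => k; rewrite Rplus_0_l.
  have C := picard_step_contr lg (picard_iterate_lip k)
    (M := 2 * B * (/ 2) ^ k) _ j t0.
  have {}C : Rabs (step g t j - iterate k.+1 t j) <= 2 * B * (/ 2) ^ k / 2 * exp (2 * L * t).
    apply: C => s i s0; apply: Rle_trans (hg s i k s0) _; apply: Req_le; ring.
  have := hg t j k.+1 t0; set a := iterate k.+1 t j in C * => h1.
  have -> : step g t j - g t j = (step g t j - a) - (g t j - a) by ring.
  apply: Rle_trans (Rabs_triang _ _) _; rewrite Rabs_Ropp; rewrite /= in h1; lra.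
(* The curve [g] is arbitrary at negative times; [step g] agrees with it from 0 on and is
   differentiable at 0 from both sides. *)
exists (step g); split.
  by apply: functional_extensionality => i; exact: picard_step0.
move=> t i t0; have -> : step g t = g t.
  by apply: functional_extensionality => j; exact: fix_g.
have := picard_step_derive i t lg; rewrite /field Rmax_right //.
Qed.

End Picard.

(** * Right inverses of Jacobian matrices *)

Section RightInverse.
Variables (p n : nat).
Implicit Types (A : 'I_p -> 'I_n -> R) (w u : Rn p).

Definition trmul A u : Rn n := fun m => sumR (fun k => A k m * u k).
Definition l1norm u : R := sumR (fun k => Rabs (u k)).
(** A quantitative form of surjectivity of [A]. The l1 norm suits the coordinatewise bound obtained
    from [kappa_df]. *)
Definition nondeg A nu := forall u, nu * l1norm u <= vnorm (trmul A u).
Definition gram A : 'M[R]_p := \matrix_(i, j) sumR (fun m => A i m * A j m).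

(* When [eta <= det ^ 2] the last factor is [1 / det], so that this is the
   solution of [gram A u = w]; in general it is Lipschitz in [A] and [w]. *)
Definition gram_solve eta A w : Rn p := fun i =>
  sumR (fun j => adjugate (gram A) i j * w j) *
  (determinant (gram A) * / Rmax (determinant (gram A) * determinant (gram A)) eta).

(** Without truncation this is -A^T (A A^T)^-1 w, the solution of A v = -w of least norm. *)
Definition lift_field eta A w : Rn n := fun m => - trmul A (gram_solve eta A w) m.

Lemma l1norm_ge0 u : 0 <= l1norm u.
Proof. by apply: sumR_ge0 => i; exact: Rabs_pos. Qed.

Lemma gram_trmul A u k :
  sumR (fun m => A k m * trmul A u m) = sumR (fun i => gram A k i * u i).
Proof.
transitivity (sumR (fun m => sumR (fun i => A k m * (A i m * u i)))).
  by apply: eq_sumR => m; rewrite -sumRZ.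
rewrite exchange_sumR; apply: eq_sumR => i; rewrite mxE Rmult_comm -sumRZ.
by apply: eq_sumR => m; ring.
Qed.

Lemma trmul_sqr A u : vnorm (trmul A u) * vnorm (trmul A u) =
  sumR (fun k => u k * sumR (fun i => gram A k i * u i)).
Proof.
rewrite vnorm_sqr /dot.
transitivity (sumR (fun m => sumR (fun k => u k * (A k m * trmul A u m)))).
  apply: eq_sumR => m; rewrite {1}/trmul Rmult_comm -sumRZ.
  by apply: eq_sumR => k; ring.
rewrite exchange_sumR; apply: eq_sumR => k; rewrite -gram_trmul -sumRZ //.
Qed.

Lemma gram_solveP eta A w k : 0 < eta -> eta <= determinant (gram A) * determinant (gram A) ->
  sumR (fun i => gram A k i * gram_solve eta A w i) = w k.
Proof.
move=> e0 he; set d := determinant (gram A) in he *.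
have d0 : d <> 0 by move=> d0; rewrite d0 in he; lra.
have E j : sumR (fun i => gram A k i * adjugate (gram A) i j) = if j == k then d else 0.
  have := f_equal (fun M : 'M[R]_p => M k j) (mul_mx_adj (gram A)).
  rewrite !mxE => H; transitivity ((determinant (gram A)) *+ (k == j))%R; first exact: H.
  by rewrite eq_sym; case: (j == k).
transitivity (sumR (fun i => sumR (fun j => gram A k i * adjugate (gram A) i j *
    (w j * (d * / (d * d)))))).
  apply: eq_sumR => i; rewrite /gram_solve -/d Rmax_left //.
  rewrite Rmult_comm Rmult_assoc Rmult_comm -sumRZ.
  by apply: eq_sumR => j; ring.
rewrite exchange_sumR (sumRD1 _ k) [X in _ + X]sumR_eq0.
  transitivity (sumR (fun i => gram A k i * adjugate (gram A) i k) * (w k * (d * / (d * d)))).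
    rewrite Rplus_0_r [RHS]Rmult_comm -sumRZ; apply: eq_sumR => i; ring.
  by rewrite E eqxx; field.
move=> j; case: (altP (j =P k)) => // ne.
transitivity (sumR (fun i => gram A k i * adjugate (gram A) i j) * (w j * (d * / (d * d)))).
  by rewrite [RHS]Rmult_comm -sumRZ; apply: eq_sumR => i; ring.
by rewrite E (negbTE ne) Rmult_0_l.
Qed.

Lemma lift_fieldP eta A w k : 0 < eta -> eta <= determinant (gram A) * determinant (gram A) ->
  sumR (fun m => A k m * lift_field eta A w m) = - w k.
Proof.
move=> e0 he; rewrite -(@gram_solveP eta A w k e0 he) -gram_trmul.
rewrite (_ : - sumR _ =
  -1 * sumR (fun m => A k m * trmul A (gram_solve eta A w) m)); last ring.
by rewrite -sumRZ; apply: eq_sumR => m; rewrite /lift_field; ring.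
Qed.

Lemma vnorm_opp (x : Rn n) : vnorm (fun m => - x m) = vnorm x.
Proof. by rewrite /vnorm; congr sqrt; apply: eq_sumR => i; ring. Qed.

(** With G u = w one has |A^T u|^2 = u . w <= W |u|_1 and nu |u|_1 <= |A^T u|; multiply the first by
    nu and divide by |A^T u|. No operator norm of the inverse is involved. *)
Lemma lift_field_le eta A w nu W : 0 < eta ->
  eta <= determinant (gram A) * determinant (gram A) ->
  0 < nu -> nondeg A nu -> 0 <= W -> (forall k, Rabs (w k) <= W) ->
  nu * vnorm (lift_field eta A w) <= W.
Proof.
move=> e0 he nu0 nd W0 hw; set u := gram_solve eta A w.
rewrite (vnorm_opp (trmul A u)); set N := vnorm _; have N0 : 0 <= N by exact: vnorm_ge0.
have H : N * N <= W * l1norm u.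
  rewrite /N trmul_sqr /l1norm -sumRZ; apply: ler_sumR => k.
  rewrite gram_solveP //; apply: Rle_trans (Rle_abs _) _; rewrite Rabs_mult Rmult_comm.
  by apply: Rmult_le_compat_r; [exact: Rabs_pos|exact: hw].
have := nd u; rewrite -/N; have := l1norm_ge0 u => l0 h.
case: (Req_dec N 0) => [->|ne]; first by rewrite Rmult_0_r.
apply: (Rmult_le_reg_r N); first lra.
nra.
Qed.

(** A kernel vector u of the Gram matrix satisfies |A^T u|^2 = u . (G u) = 0, which [nondeg] forbids
    unless u = 0. *)
Lemma nondeg_det_neq0 A nu : 0 < nu -> nondeg A nu -> determinant (gram A) <> 0.
Proof.
move=> nu0 nd d0; have /det0P [v v0 hv] : (determinant (gram A) == 0)%R by apply/eqP.
pose u : Rn p := fun i => v ord0 i.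
have Z k : sumR (fun i => gram A k i * u i) = 0.
  have := f_equal (fun M : 'rV[R]_p => M ord0 k) hv; rewrite !mxE => H.
  apply: etrans H; apply: eq_sumR => i; rewrite /u [RHS]Rmult_comm.
  congr (_ * _); rewrite !mxE.
  by apply: eq_sumR => m; ring.
have := trmul_sqr A u; rewrite sumR_eq0 => [N|k]; last by rewrite Z; ring.
have := nd u; have := l1norm_ge0 u; have := vnorm_ge0 (trmul A u) => a b c.
have z : vnorm (trmul A u) = 0 by nra.
have u0 : l1norm u <= 0 by nra.
case/negP: v0; apply/eqP/matrixP => i j; rewrite ord1 mxE.
have := @term_le_sumR p (fun k => Rabs (u k)) j (fun k => Rabs_pos _).
rewrite -/(l1norm u) => h; have h' := Rabs_pos (u j).
by apply: Rabs_eq_0; rewrite -/(u j); lra.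
Qed.

Lemma det_bounded m c : 0 <= c -> exists K, 0 < K /\ forall N : 'M[R]_m,
  (forall i j, Rabs (N i j) <= c) -> Rabs (determinant N) <= K.
Proof.
move=> c0; set K := \big[Rplus/0]_(s : 'S_m) (1 * \big[Rmult/1]_(i < m) c).
have K0 : 0 <= K.
  apply: (big_ind (fun x => 0 <= x)) => [|x y|s _]; try lra.
  by rewrite Rmult_1_l; apply: (big_ind (fun x => 0 <= x)) => [|x y|i _] //; [lra|nra].
exists (K + 1); split=> [|N hN]; first lra.
suff : Rabs (determinant N) <= K by lra.
rewrite /determinant /K.
apply: (big_ind2 (fun x y => Rabs x <= y)) => [|x y x' y' h h'|s _].
- by rewrite Rabs_R0; exact: Rle_refl.
- by apply: Rle_trans (Rabs_triang _ _) _; exact: Rplus_le_compat.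
rewrite Rabs_mult; apply: Rmult_le_compat; try exact: Rabs_pos.
  by case: (odd_perm s); rewrite ?expr1 ?expr0 ?Rabs_Ropp Rabs_R1; exact: Rle_refl.
apply: (big_ind2 (fun x y => Rabs x <= y)) => [|x y x' y' h h'|i _] //.
- by rewrite Rabs_R1; exact: Rle_refl.
- by rewrite Rabs_mult; apply: Rmult_le_compat => //; exact: Rabs_pos.
Qed.

(** A threshold that depends on [nu] alone. A column x of the inverse Gram matrix satisfies |A^T
    x|^2 <= |x|_1, hence nu^2 |x|_1 <= 1. So the entries of the inverse are bounded, its determinant
    is at most some K, and the determinant of the Gram matrix is at least 1/K in absolute value. *)
Lemma nondeg_det_lb nu : 0 < nu -> exists eta, 0 < eta /\
  forall A, nondeg A nu -> eta <= determinant (gram A) * determinant (gram A).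
Proof.
move=> nu0; have c0 : 0 <= / (nu * nu) by apply: Rlt_le; apply: Rinv_0_lt_compat; nra.
have [K [K0 hK]] := det_bounded p c0.
exists (/ (K * K)); split; first by apply: Rinv_0_lt_compat; nra.
move=> A nd; have d0 := nondeg_det_neq0 nu0 nd.
have uM : gram A \in unitmx by rewrite unitmxE GRing.unitfE; apply/eqP.
have : Rabs (determinant (invmx (gram A))) <= K.
  apply: hK => i j; pose x : Rn p := fun i => invmx (gram A) i j.
  have E k : sumR (fun i => gram A k i * x i) = if k == j then 1 else 0.
    have := f_equal (fun M : 'M[R]_p => M k j) (mulmxV uM); rewrite !mxE => H.
    by transitivity ((k == j)%:R : R)%R; [exact: H|case: (k == j)].
  have N : vnorm (trmul A x) * vnorm (trmul A x) <= l1norm x.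
    rewrite trmul_sqr; apply: ler_sumR => k; rewrite E.
    by case: (k == j); rewrite ?Rmult_1_r ?Rmult_0_r; [exact: Rle_abs|exact: Rabs_pos].
  have := nd x; have := vnorm_ge0 (trmul A x); have := l1norm_ge0 x => a b c.
  apply: (Rle_trans _ (l1norm x)).
    exact: (@term_le_sumR p (fun k => Rabs (x k)) i (fun k => Rabs_pos _)).
  case: (Req_dec (l1norm x) 0) => [->//|ne].
  have n2 : 0 < nu * nu by nra.
  apply: (Rmult_le_reg_l (nu * nu)) => //; rewrite Rinv_r; last lra.
  apply: (Rmult_le_reg_r (l1norm x)); first lra.
  have nl : 0 <= nu * l1norm x by nra.
  have := Rmult_le_compat _ _ _ _ nl nl c c; lra.
have E : determinant (gram A) * determinant (invmx (gram A)) = 1.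
  by have := det_mulmx (gram A) (invmx (gram A)); rewrite mulmxV // det1 => H; exact: esym H.
move: (determinant (gram A)) (determinant (invmx (gram A))) E d0 => d e E d0 he.
have ek : e * e <= K * K.
  have := Rabs_pos e; have -> : e * e = Rabs e * Rabs e.
    by rewrite -Rabs_mult Rabs_pos_eq //; nra.
  nra.
have -> : d * d = / (e * e).
  have e1 : e <> 0 by move=> h; rewrite h in E; lra.
  have -> : d = / e by apply: (Rmult_eq_reg_r e) => //; rewrite E Rinv_l.
  by rewrite Rinv_mult.
apply: Rinv_le_contravar => //.
have e1 : e <> 0 by move=> h; rewrite h in E; lra.
nra.
Qed.

End RightInverse.

(** * Bounded Lipschitz functions *)

Section BoundedLipschitz.
Variables (X : Type) (rel : R -> X -> X -> Prop).
Hypothesis rel_ge0 : forall c x y, rel c x y -> 0 <= c.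

(** The relation [rel c x y] encodes both a domain and a distance at most c. Boundedness is included
    so that the class is stable under products, hence under determinants and adjugates. *)
Definition blip (F : X -> R) := exists K, 0 <= K /\ forall c x y, rel c x y ->
  Rabs (F x) <= K /\ Rabs (F y) <= K /\ Rabs (F x - F y) <= K * c.

Lemma blip_const k : blip (fun _ => k).
Proof.
exists (Rabs k); split; first exact: Rabs_pos.
move=> c x y /rel_ge0 c0; rewrite Rminus_diag Rabs_R0; do 2 (split; first exact: Rle_refl).
by apply: Rmult_le_pos => //; exact: Rabs_pos.
Qed.

Lemma blipD F G : blip F -> blip G -> blip (fun x => F x + G x).
Proof.
move=> [K [K0 h]] [M [M0 h']]; exists (K + M); split; first lra.
move=> c x y r; have [a1 [a2 a3]] := h c x y r; have [b1 [b2 b3]] := h' c x y r.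
split; first by have := Rabs_triang (F x) (G x); lra.
split; first by have := Rabs_triang (F y) (G y); lra.
have -> : F x + G x - (F y + G y) = (F x - F y) + (G x - G y) by ring.
by have := Rabs_triang (F x - F y) (G x - G y); lra.
Qed.

Lemma blipM F G : blip F -> blip G -> blip (fun x => F x * G x).
Proof.
move=> [K [K0 h]] [M [M0 h']]; exists (2 * (K * M)); split; first nra.
move=> c x y r; have [a1 [a2 a3]] := h c x y r; have [b1 [b2 b3]] := h' c x y r.
have c0 := rel_ge0 r; have KM : 0 <= K * M by nra.
have P z : Rabs (F z) <= K -> Rabs (G z) <= M -> Rabs (F z * G z) <= K * M.
  by move=> ? ?; rewrite Rabs_mult; apply: Rmult_le_compat => //; exact: Rabs_pos.
have Px := P x a1 b1; have Py := P y a2 b2.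
split; first lra; split; first lra.
have -> : F x * G x - F y * G y = F x * (G x - G y) + (F x - F y) * G y by ring.
apply: Rle_trans (Rabs_triang _ _) _; rewrite !Rabs_mult.
have H1 : Rabs (F x) * Rabs (G x - G y) <= K * (M * c).
  by apply: Rmult_le_compat => //; exact: Rabs_pos.
have H2 : Rabs (F x - F y) * Rabs (G y) <= K * c * M.
  by apply: Rmult_le_compat => //; exact: Rabs_pos.
lra.
Qed.

Lemma blip_ext F G : (forall x, F x = G x) -> blip F -> blip G.
Proof. by move=> e; rewrite (functional_extensionality F G e). Qed.

Lemma blipN F : blip F -> blip (fun x => - F x).
Proof.
move=> h; apply: blip_ext (blipM (blip_const (-1)) h) => x; ring.
Qed.

Lemma blip_big_sum I (r : seq I) (F : I -> X -> R) : (forall i, blip (F i)) ->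
  blip (fun x => \big[Rplus/0]_(i <- r) F i x).
Proof.
move=> h; elim: r => [|i r ih].
  by apply: blip_ext (blip_const 0) => x; rewrite big_nil.
by apply: blip_ext (blipD (h i) ih) => x; rewrite big_cons.
Qed.

Lemma blip_big_prod I (r : seq I) (F : I -> X -> R) : (forall i, blip (F i)) ->
  blip (fun x => \big[Rmult/1]_(i <- r) F i x).
Proof.
move=> h; elim: r => [|i r ih].
  by apply: blip_ext (blip_const 1) => x; rewrite big_nil.
by apply: blip_ext (blipM (h i) ih) => x; rewrite big_cons.
Qed.

Lemma blip_sumR m (F : 'I_m -> X -> R) : (forall i, blip (F i)) ->
  blip (fun x => sumR (fun i => F i x)).
Proof. exact: blip_big_sum. Qed.

Lemma blip_det m (A : X -> 'M[R]_m) : (forall i j, blip (fun x => A x i j)) ->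
  blip (fun x => determinant (A x)).
Proof.
move=> h; apply: (@blip_big_sum _ _ (fun (s : 'S_m) x =>
  ((-1) ^+ s)%R * \big[Rmult/1]_(i < m) A x i (s i))).
move=> s; apply: blipM; first exact: blip_const.
by apply: (@blip_big_prod _ _ (fun i x => A x i (s i))) => i; exact: h.
Qed.

Lemma blip_adj m (A : X -> 'M[R]_m) i j : (forall i j, blip (fun x => A x i j)) ->
  blip (fun x => adjugate (A x) i j).
Proof.
move=> h; apply: (@blip_ext (fun x => ((-1) ^+ (j + i))%R *
    determinant (row' j (col' i (A x))))).
  by move=> x; rewrite mxE.
apply: blipM; first exact: blip_const.
by apply: blip_det => k l; apply: blip_ext (h (lift j k) (lift i l)) => x; rewrite !mxE.
Qed.

(** On [eta, infinity) the function 1/z is bounded by 1/eta and has Lipschitz constant 1/eta^2. *)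
Lemma blip_inv_max F eta : 0 < eta -> blip F -> blip (fun x => / Rmax (F x) eta).
Proof.
move=> e0 [K [K0 h]]; have i0 := Rinv_0_lt_compat _ e0.
have i1 : 0 <= / eta * / eta by nra.
exists (/ eta + K * (/ eta * / eta)); split; first nra.
have m0 z : 0 < / Rmax (F z) eta <= / eta.
  split; first by apply: Rinv_0_lt_compat; apply: Rlt_le_trans e0 _; exact: Rmax_r.
  by apply: Rinv_le_contravar => //; exact: Rmax_r.
move=> c x y r; have [_ [_ a3]] := h c x y r; have c0 := rel_ge0 r.
have mx := m0 x; have my := m0 y; rewrite (Rabs_pos_eq (/ Rmax (F x) eta)); last lra.
rewrite (Rabs_pos_eq (/ Rmax (F y) eta)); last lra.
have Ke : 0 <= K * (/ eta * / eta) by nra.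
split; first lra; split; first lra.
have px : 0 < Rmax (F x) eta by apply: Rlt_le_trans e0 _; exact: Rmax_r.
have py : 0 < Rmax (F y) eta by apply: Rlt_le_trans e0 _; exact: Rmax_r.
have -> : / Rmax (F x) eta - / Rmax (F y) eta =
   (Rmax (F y) eta - Rmax (F x) eta) * (/ Rmax (F x) eta * / Rmax (F y) eta) by field; lra.
rewrite Rabs_mult (Rabs_pos_eq (_ * _)); last nra.
have D : Rabs (Rmax (F y) eta - Rmax (F x) eta) <= K * c.
  apply: Rle_trans a3; have := Rle_abs (F x - F y); have := Rle_abs (- (F x - F y)).
  rewrite Rabs_Ropp => ? ?; apply: Rabs_le.
  by rewrite /Rmax; case: Rle_dec; case: Rle_dec; lra.
apply: Rle_trans (Rmult_le_compat _ _ _ _ (Rabs_pos _) _ D (_ : _ <= / eta * / eta)) _.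
- nra.
- by apply: Rmult_le_compat; lra.
- nra.
Qed.

(** The field is polynomial in the entries of [A] and [w], except for the truncated reciprocal; this
    is the purpose of the [Rmax] in [gram_solve]. *)
Lemma blip_lift_field p n (A : X -> 'I_p -> 'I_n -> R) (w : X -> Rn p) eta m :
  0 < eta -> (forall k m, blip (fun x => A x k m)) -> (forall k, blip (fun x => w x k)) ->
  blip (fun x => lift_field eta (A x) (w x) m).
Proof.
move=> e0 hA hw; apply: blipN.
have g i j : blip (fun x => gram (A x) i j).
  apply: (@blip_ext (fun x => sumR (fun m => A x i m * A x j m))).
    by move=> x; rewrite mxE.
  by apply: (@blip_sumR _ (fun m x => A x i m * A x j m)) => k; exact: blipM.
have d := blip_det g.
apply: (@blip_sumR _ (fun k x => A x k m * gram_solve eta (A x) (w x) k)) => k.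
apply: blipM => //; apply: blipM.
  apply: (@blip_sumR _ (fun j x => adjugate (gram (A x)) k j * w x j)) => j.
  by apply: blipM => //; exact: blip_adj.
apply: blipM => //; apply: blip_inv_max => //; exact: blipM.
Qed.

End BoundedLipschitz.

(** * Transport of zeros along a deformation *)

Definition mix n p (t : R) (g1 g2 : Rn n -> Rn p) : Rn n -> Rn p :=
  fun x k => (1 - t) * g1 x k + t * g2 x k.

Definition mixjac n p (t : R) (g1 g2 : Rn n -> Rn p) (x : Rn n) (k : 'I_p) (m : 'I_n) : R :=
  (1 - t) * grad g1 k x m + t * grad g2 k x m.

Lemma nondeg_le p n (A : 'I_p -> 'I_n -> R) nu nu' : nu' <= nu -> nondeg A nu -> nondeg A nu'.
Proof. by move=> h nd u; have := nd u; have := l1norm_ge0 u; nra. Qed.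

(** Every admissible truncation level gives the same field; the squared determinant itself serves as
    the canonical level. *)
Lemma lift_field_eta p n eta (A : 'I_p -> 'I_n -> R) w :
  eta <= determinant (gram A) * determinant (gram A) ->
  lift_field eta A w = lift_field (determinant (gram A) * determinant (gram A)) A w.
Proof.
move=> h; rewrite /lift_field /gram_solve Rmax_left // Rmax_left //; exact: Rle_refl.
Qed.

Lemma lift_fieldN p n eta (A : 'I_p -> 'I_n -> R) w m :
  lift_field eta A (fun k => - w k) m = - lift_field eta A w m.
Proof.
rewrite /lift_field; congr (- _).
rewrite (_ : - trmul A (gram_solve eta A w) m =
  -1 * trmul A (gram_solve eta A w) m); last ring.
rewrite /trmul -sumRZ; apply: eq_sumR => k; rewrite /gram_solve.
rewrite (_ : sumR (fun j => _ * - w j) = -1 * sumR (fun j => adjugate (gram A) k j * w j)).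
  ring.
by rewrite -sumRZ; apply: eq_sumR => j; ring.
Qed.

Definition clamp a b z := Rmax a (Rmin b z).

Lemma clamp_in a b z : a <= b -> a <= clamp a b z <= b.
Proof. by move=> ab; rewrite /clamp /Rmax /Rmin; case: Rle_dec; case: Rle_dec; lra. Qed.

Lemma clamp_id a b z : a <= z <= b -> clamp a b z = z.
Proof. by move=> ab; rewrite /clamp /Rmax /Rmin; case: Rle_dec; case: Rle_dec; lra. Qed.

Lemma clamp_lip a b z z' : Rabs (clamp a b z - clamp a b z') <= Rabs (z - z').
Proof.
apply: (Rle_trans _ (Rabs (Rmin b z - Rmin b z'))).
  rewrite /clamp; move: (Rmin b z) (Rmin b z') => u v.
  have := Rle_abs (u - v); have := Rle_abs (- (u - v)); rewrite Rabs_Ropp => ? ?.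
  by apply: Rabs_le; rewrite /Rmax; case: Rle_dec; case: Rle_dec; lra.
have := Rle_abs (z - z'); have := Rle_abs (- (z - z')); rewrite Rabs_Ropp => ? ?.
by apply: Rabs_le; rewrite /Rmin; case: Rle_dec; case: Rle_dec; lra.
Qed.

Section Transport.
Variables (n p r : nat) (Sigma : Rn n -> Prop) (K w rho : R).
Hypothesis Sigma_closed : rn_closed Sigma.
Hypothesis Sigma0 : Sigma (@vzero n).
Hypothesis K0 : 0 <= K.
Hypothesis w0 : 0 < w.
Hypothesis rho0 : 0 < rho.

Local Notation d := (dist_set Sigma).

Definition lip_box (F : Rn n -> R) := forall x y c, in_box rho x -> in_box rho y ->
  (forall j, Rabs (x j - y j) <= c) -> 0 <= c ->
  Rabs (F x) <= K /\ Rabs (F x - F y) <= K * c.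

Record half_deformation (g : Rn n -> Rn p) : Prop := HalfDeformation {
  hd_C1 : forall k, Cs 1 (rn_ball rho) (fun x => g x k);
  hd_lip : forall k, lip_box (fun x => g x k);
  hd_lip1 : forall k m, lip_box (fun x => grad g k x m) }.

(** The conditions are symmetric in [g1] and [g2] with the same constants, so each result about the
    forward transport also holds for the backward one. *)
Record deformation (g1 g2 : Rn n -> Rn p) : Prop := Deformation {
  df_1 : half_deformation g1;
  df_2 : half_deformation g2;
  df_diff : forall x k, vnorm x < rho -> Rabs (g2 x k - g1 x k) <= K * d x ^ (r + 1);
  df_nondeg : forall t x, 0 <= t <= 1 -> vnorm x < rho ->
    vnorm (mix t g1 g2 x) <= w * d x ^ (r + 1) -> nondeg (mixjac t g1 g2 x) (d x ^ r) }.

Lemma mix_swap t (g1 g2 : Rn n -> Rn p) : mix (1 - t) g1 g2 = mix t g2 g1.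
Proof.
apply: functional_extensionality => x; apply: functional_extensionality => k.
by rewrite /mix; ring.
Qed.

Lemma mixjac_swap t (g1 g2 : Rn n -> Rn p) : mixjac (1 - t) g1 g2 = mixjac t g2 g1.
Proof.
apply: functional_extensionality => x; apply: functional_extensionality => k.
by apply: functional_extensionality => m; rewrite /mixjac; ring.
Qed.

Lemma deformation_swap g1 g2 : deformation g1 g2 -> deformation g2 g1.
Proof.
case=> h1 h2 hd hn; split=> // [x k hx|t x ht hx].
  by rewrite Rabs_minus_sym; exact: hd.
rewrite -mix_swap -mixjac_swap; apply: hn => //; lra.
Qed.

(** * The velocity field and its truncated flow *)

Definition velocity eta g1 g2 t (x : Rn n) : Rn n :=
  lift_field eta (mixjac t g1 g2 x) (fun k : 'I_p => g2 x k - g1 x k).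

(** Taken as the level [eta], it yields the untruncated velocity. *)
Definition sqdet g1 g2 t x : R :=
  determinant (gram (@mixjac n p t g1 g2 x)) * determinant (gram (mixjac t g1 g2 x)).

Lemma in_box_ball (x : Rn n) : vnorm x < rho -> in_box rho x.
Proof. by move=> h j; have := coord_le_vnorm x j; lra. Qed.

Definition tx_rel c (a b : R * Rn n) :=
  (0 <= a.1 <= 1 /\ 0 <= b.1 <= 1) /\ (in_box rho a.2 /\ in_box rho b.2) /\
  Rabs (a.1 - b.1) <= c /\ forall j, Rabs (a.2 j - b.2 j) <= c.

Lemma tx_rel_ge0 c a b : tx_rel c a b -> 0 <= c.
Proof. by case=> _ [_ [h _]]; have := Rabs_pos (a.1 - b.1); lra. Qed.

Lemma blip_space F : lip_box F -> blip tx_rel (fun a => F a.2).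
Proof.
move=> h; exists K; split=> // c a b rl; have c0 := tx_rel_ge0 rl.
case: rl => _ [[ha hb] [_ hc]]; have [h1 h2] := h _ _ _ ha hb hc c0.
split=> //; split=> //; apply: (proj1 (h _ _ c hb ha _ c0)) => j.
by rewrite Rabs_minus_sym; exact: hc.
Qed.

Lemma blip_time : blip tx_rel (fun a => a.1).
Proof.
exists 1; split; first lra.
move=> c a b [[ha hb] [_ [h _]]].
by split; [rewrite Rabs_pos_eq; lra|split; [rewrite Rabs_pos_eq; lra|lra]].
Qed.

Lemma blip_velocity eta g1 g2 m : 0 < eta -> half_deformation g1 -> half_deformation g2 ->
  blip tx_rel (fun a => velocity eta g1 g2 a.1 a.2 m).
Proof.
move=> e0 h1 h2; have c := blip_const tx_rel_ge0.
apply: (blip_lift_field tx_rel_ge0 (A := fun a => mixjac a.1 g1 g2 a.2)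
   (w := fun a k => g2 a.2 k - g1 a.2 k)) => // [k l|k].
  apply: blipD; apply: (blipM tx_rel_ge0).
  - exact: blipD (c 1) (blipN tx_rel_ge0 blip_time).
  - exact: (blip_space (hd_lip1 h1 k l)).
  - exact: blip_time.
  - exact: (blip_space (hd_lip1 h2 k l)).
apply: blipD; first exact: (blip_space (hd_lip h2 k)).
apply: (blipN tx_rel_ge0); exact: (blip_space (hd_lip h1 k)).
Qed.

Lemma velocity_lip eta g1 g2 : 0 < eta -> half_deformation g1 -> half_deformation g2 ->
  exists L, 0 <= L /\ forall c a b m, tx_rel c a b ->
    Rabs (velocity eta g1 g2 a.1 a.2 m) <= L /\
    Rabs (velocity eta g1 g2 a.1 a.2 m - velocity eta g1 g2 b.1 b.2 m) <= L * c.
Proof.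
move=> e0 h1 h2.
have [|L [L0 hL]] := @fin_large n (fun m L => forall c a b, tx_rel c a b ->
    Rabs (velocity eta g1 g2 a.1 a.2 m) <= L /\
    Rabs (velocity eta g1 g2 a.1 a.2 m - velocity eta g1 g2 b.1 b.2 m) <= L * c).
  move=> m; have [L [L0 hL]] := blip_velocity m e0 h1 h2; exists L; split=> //.
  move=> L' LL c a b rl; have [q1 [_ q3]] := hL _ _ _ rl; have c0 := tx_rel_ge0 rl.
  by split; [lra|nra].
by exists L; split=> // c a b m; exact: hL.
Qed.

(* Clamping time and space makes the velocity field globally Lipschitz. *)
Lemma velocity_flow eta g1 g2 x : 0 < eta -> half_deformation g1 -> half_deformation g2 ->
  exists gam : R -> Rn n, gam 0 = x /\ forall t j, 0 <= t -> exists v,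
    is_derive (fun s => gam s j) t v /\
    (t <= 1 -> in_box rho (gam t) -> v = velocity eta g1 g2 t (gam t) j).
Proof.
move=> e0 h1 h2; have [L [L0 hL]] := velocity_lip e0 h1 h2.
pose cl (y : Rn n) : Rn n := fun j => clamp (- rho) rho (y j).
have clb y : in_box rho (cl y).
  by move=> j; apply: Rabs_le; apply: clamp_in; lra.
have rl t s y z c : Rabs (t - s) <= c -> (forall j, Rabs (y j - z j) <= c) ->
    tx_rel c (clamp 0 1 t, cl y) (clamp 0 1 s, cl z).
  move=> ht hy; split; first by split; apply: clamp_in; lra.
  split; first by split; exact: clb.
  split; first by apply: Rle_trans (clamp_lip _ _ _ _) ht.
  by move=> j; apply: Rle_trans (clamp_lip _ _ _ _) (hy j).
(* The constant is raised to L + 1 because [picard] wants one that is at least 1. *)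
have [|||gam [g0 hg]] := @picard n (fun t y => velocity eta g1 g2 (clamp 0 1 t) (cl y))
  (L + 1) L x _ L0.
- lra.
- move=> t s y z c i ht hy; have := rl t s y z c ht hy => R1.
  have [_ q] := hL c _ _ i R1; apply: Rle_trans q _; have := tx_rel_ge0 R1; nra.
- have z a : Rabs (a - a) <= 0 by rewrite Rminus_diag Rabs_R0; lra.
  move=> t y i; have [q _] := hL 0 _ _ i (rl t t y y 0 (z t) (fun j => z (y j))).
  exact: q.
exists gam; split=> // t j t0; eexists; split; first exact: hg.
move=> t1 hb; rewrite clamp_id; last lra.
suff -> : cl (gam t) = gam t by [].
apply: functional_extensionality => i; apply: clamp_id.
by have /Rabs_le_between := hb i.
Qed.

Lemma mix_derive g1 g2 (gam : R -> Rn n) (v : Rn n) t k :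
  half_deformation g1 -> half_deformation g2 -> vnorm (gam t) < rho ->
  (forall j, is_derive (fun s => gam s j) t (v j)) ->
  is_derive (fun s => mix s g1 g2 (gam s) k) t
    (sumR (fun m => mixjac t g1 g2 (gam t) k m * v m) + (g2 (gam t) k - g1 (gam t) k)).
Proof.
move=> h1 h2 hr hv; have ob := @rn_ball_open n rho.
have CR g : half_deformation g ->
    is_derive (fun s => g (gam s) k) t (sumR (fun m => grad g k (gam t) m * v m)).
  move=> h; apply: (chain_rule (U := rn_ball rho) (F := fun x => g x k)
    (G := fun m x => grad g k x m)) => // [i|i]; rewrite /grad.
    exact: (proj1 (Cs_pd i ob (hd_C1 h k))).
  exact: (proj2 (Cs_pd i ob (hd_C1 h k))).
have D1 : is_derive (fun s => 1 - s) t (-1) by auto_derive => //; ring.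
have D2 : is_derive (fun s : R => s) t 1 by auto_derive.
have E1 := is_derive_mult _ _ t _ _ D1 (CR _ h1) Rmult_comm.
have E2 := is_derive_mult _ _ t _ _ D2 (CR _ h2) Rmult_comm.
have := is_derive_plus _ _ t _ _ E1 E2.
congr (is_derive _ _ _); rewrite /plus /mult /=.
have -> : sumR (fun m => mixjac t g1 g2 (gam t) k m * v m) =
   (1 - t) * sumR (fun m => grad g1 k (gam t) m * v m) +
   t * sumR (fun m => grad g2 k (gam t) m * v m).
  by rewrite -!sumRZ -sumRD; apply: eq_sumR => m; rewrite /mixjac; ring.
ring.
Qed.

Lemma velocity_kills g1 g2 eta t x k : 0 < eta -> eta <= sqdet g1 g2 t x ->
  sumR (fun m => mixjac t g1 g2 x k m * velocity eta g1 g2 t x m) + (g2 x k - g1 x k) = 0.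
Proof. by move=> e0 he; rewrite lift_fieldP //; ring. Qed.

(** Inverting D_t costs a factor d^r, while g2 - g1 is of size d^(r+1); one power of d survives. *)
Lemma velocity_le g1 g2 eta t x j : deformation g1 g2 -> 0 < eta ->
  eta <= sqdet g1 g2 t x -> 0 <= t <= 1 -> vnorm x < rho -> 0 < d x ->
  vnorm (mix t g1 g2 x) <= w * d x ^ (r + 1) ->
  Rabs (velocity eta g1 g2 t x j) <= K * d x.
Proof.
move=> D e0 he ht hx d0 hm; have dr : 0 < d x ^ r by exact: pow_lt.
have dr1 : 0 < d x ^ (r + 1) by exact: pow_lt.
have := lift_field_le e0 he dr (df_nondeg D ht hx hm) (W := K * d x ^ (r + 1)).
move=> /(_ (fun k : 'I_p => g2 x k - g1 x k)) H.
apply: Rle_trans (coord_le_vnorm _ j) _; apply: (Rmult_le_reg_l (d x ^ r)) => //.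
apply: Rle_trans (H _ _) _.
- nra.
- by move=> k; exact: df_diff.
- by rewrite addn1 /=; apply: Req_le; ring.
Qed.

(** Using the level [sqdet] makes the notion independent of [eta], so trajectories at different
    distances from [Sigma] can be compared and reversed. *)
Definition traj g1 g2 (gam : R -> Rn n) := forall t, 0 <= t <= 1 ->
  vnorm (gam t) < rho /\ mix t g1 g2 (gam t) = @vzero p /\ 0 < d (gam t) /\
  forall j, is_derive (fun s => gam s j) t
    (velocity (sqdet g1 g2 t (gam t)) g1 g2 t (gam t) j).

Lemma traj_swap g1 g2 gam : traj g1 g2 gam -> traj g2 g1 (fun t => gam (1 - t)).
Proof.
move=> h t ht; have [|a [b [c e]]] := h (1 - t); first lra.
split=> //; split; first by rewrite -mix_swap.
split=> // j; rewrite /velocity /sqdet -mixjac_swap.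
have := is_derive_comp (fun s => gam s j) (fun s => 1 - s) t _ (-1) (e j).
move=> /(_ ltac:(auto_derive => //; ring)); congr (is_derive _ _ _).
rewrite /scal /= /mult /= /velocity /sqdet.
set x := gam (1 - t).
(* The swapped field has the opposite sign, which matches the derivative -1 of time reversal. *)
rewrite (_ : (fun k => g1 x k - g2 x k) = (fun k => - (g2 x k - g1 x k))); last first.
  by apply: functional_extensionality => k; ring.
rewrite lift_fieldN; ring.
Qed.

(** * Distance estimates, existence and stability of trajectories *)

Let E := exp (INR n * K).

Lemma E_ge1 : 1 <= E.
Proof.
have := exp_ineq1_le (INR n * K); have := pos_INR n; rewrite -/E => h1 h2; nra.
Qed.

Lemma vnorm_vzero q : vnorm (@vzero q) = 0.
Proof. by rewrite -vdistx0 vdistxx. Qed.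

Lemma sqdet_gt0 g1 g2 t x : deformation g1 g2 -> 0 <= t <= 1 -> vnorm x < rho ->
  0 < d x -> vnorm (mix t g1 g2 x) <= w * d x ^ (r + 1) -> 0 < sqdet g1 g2 t x.
Proof.
move=> D ht hx d0 hm; have dr : 0 < d x ^ r by exact: pow_lt.
have := nondeg_det_neq0 dr (df_nondeg D ht hx hm); rewrite /sqdet; nra.
Qed.

(** Since |v| <= K d(gam) <= K |gam - a|, the curve can be compared with the constant curve [a]. Of
    the two bounds, the first limits the displacement and the second keeps the curve off [Sigma]. *)
Lemma contract_to_Sigma (gam v : R -> Rn n) T a : 0 <= T <= 1 -> Sigma a ->
  (forall s j, 0 <= s <= T -> is_derive (fun s => gam s j) s (v s j)) ->
  (forall s j, 0 < s < T -> Rabs (v s j) <= K * d (gam s)) ->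
  vdist (gam T) a <= E * vdist (gam 0) a /\ vdist (gam 0) a <= E * vdist (gam T) a.
Proof.
move=> hT Sa hv hd.
apply: (@curve_gronwall n gam (fun _ => a) v (fun _ _ => 0) K T) => // [s j _|s j hs].
  exact: is_derive_const.
rewrite Rminus_0_r; apply: Rle_trans (hd s j hs) _; apply: Rmult_le_compat_l => //.
exact: dist_set_le.
Qed.

Lemma zero_in_horn (u : Rn p) x : 0 < d x -> u = @vzero p -> vnorm u <= w * d x ^ (r + 1).
Proof.
move=> d0 ->; rewrite vnorm_vzero; apply: Rmult_le_pos; first lra.
by apply: Rlt_le; exact: pow_lt.
Qed.

Lemma traj_bounds g1 g2 gam a T : deformation g1 g2 -> traj g1 g2 gam -> Sigma a ->
  0 <= T <= 1 ->
  vdist (gam T) a <= E * vdist (gam 0) a /\ vdist (gam 0) a <= E * vdist (gam T) a.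
Proof.
move=> D h Sa hT; apply: (contract_to_Sigma (v := fun s => velocity
  (sqdet g1 g2 s (gam s)) g1 g2 s (gam s))) => // [s j hs|s j hs].
  by have [|_ [_ [_ e]]] := h s; [lra|exact: e].
have [|q1 [q2 [q3 _]]] := h s; first lra.
have hz := zero_in_horn q3 q2; have hs' : 0 <= s <= 1 by lra.
apply: velocity_le => //; [exact: sqdet_gt0|exact: Rle_refl].
Qed.

Lemma traj_dist g1 g2 gam T : deformation g1 g2 -> traj g1 g2 gam -> 0 <= T <= 1 ->
  d (gam 0) / E <= d (gam T).
Proof.
move=> D h hT; have E1 := E_ge1.
apply: (dist_set_ge Sigma0) => a Sa.
have [_ q] := traj_bounds D h Sa hT; have := dist_set_le (gam 0) Sa => q'.
apply: (Rmult_le_reg_l E); first lra.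
have -> : E * (d (gam 0) / E) = d (gam 0) by field; lra.
lra.
Qed.

Lemma sqdet_lb eps : 0 < eps -> exists eta, 0 < eta /\
  forall g1 g2 t x, deformation g1 g2 -> 0 <= t <= 1 -> vnorm x < rho -> eps <= d x ->
    vnorm (mix t g1 g2 x) <= w * d x ^ (r + 1) -> eta <= sqdet g1 g2 t x.
Proof.
move=> e0; have er : 0 < eps ^ r by exact: pow_lt.
have [eta [eta0 h]] := @nondeg_det_lb p n _ er; exists eta; split=> //.
move=> g1 g2 t x D ht hx hd hm; apply: h.
apply: nondeg_le (df_nondeg D ht hx hm); apply: pow_incr; lra.
Qed.

(** At distance at least [eps] from [Sigma] all trajectories follow one truncated field with fixed
    [eta], which is Lipschitz. The constant [M] depends on [eps]. *)
Lemma traj_dep g1 g2 eps : deformation g1 g2 -> 0 < eps -> exists M, 0 < M /\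
  forall gam sig, traj g1 g2 gam -> traj g1 g2 sig ->
   (forall t, 0 <= t <= 1 -> eps <= d (gam t)) ->
   (forall t, 0 <= t <= 1 -> eps <= d (sig t)) ->
   vdist (gam 1) (sig 1) <= M * vdist (gam 0) (sig 0).
Proof.
move=> D e0; have [eta [eta0 he]] := sqdet_lb e0.
have [L [L0 hL]] := velocity_lip eta0 (df_1 D) (df_2 D).
exists (exp (INR n * L)); split; first exact: exp_pos.
move=> gam sig hg hs eg es.
have V c t j : traj g1 g2 c -> (forall t, 0 <= t <= 1 -> eps <= d (c t)) -> 0 <= t <= 1 ->
    is_derive (fun s => c s j) t (velocity eta g1 g2 t (c t) j).
  move=> hc ec ht; have [q1 [q2 [q3 q4]]] := hc t ht.
  rewrite /velocity lift_field_eta; first exact: q4.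
  by apply: he => //; [exact: ec|exact: zero_in_horn].
have [] := @curve_gronwall n gam sig (fun t => velocity eta g1 g2 t (gam t))
  (fun t => velocity eta g1 g2 t (sig t)) L 1 L0 => //; first lra.
- by move=> s j hs'; exact: V.
- by move=> s j hs'; exact: V.
move=> s j hs'; have [|q1 _] := hg s; first lra.
have [|q2 _] := hs s; first lra.
apply: (proj2 (hL _ (s, gam s) (s, sig s) j _)); split=> /=; first lra.
split; first by split; exact: in_box_ball.
by split; [rewrite Rminus_diag Rabs_R0; exact: vdist_ge0|move=> i; exact: coord_le_vdist].
Qed.

(** A bootstrap: the truncated flow exists for all time, and it is the true flow as long as it stays
    in the region where the truncation is inactive. The estimates valid there place it strictly
    inside that region, so it cannot leave. The radius rho / E allows for the growth |gam| <= E
    |x|. *)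
Lemma traj_exists g1 g2 x : deformation g1 g2 -> vnorm x < rho / E -> g1 x = @vzero p ->
  ~ Sigma x -> exists gam, gam 0 = x /\ traj g1 g2 gam.
Proof.
move=> D hx gx nS; have d0 := dist_set_gt0 Sigma0 Sigma_closed nS; have E1 := E_ge1.
have Ex : E * vnorm x < rho.
  have := Rmult_lt_compat_l E _ _ ltac:(lra) hx.
  by have -> : E * (rho / E) = rho by field; lra.
(* Half of the lower bound d(x) / E that Gronwall will guarantee; the margin makes the strict
   condition in [Q] recoverable. *)
set eps := d x / E / 2.
have e1 : 0 < d x / E by apply: Rdiv_lt_0_compat; lra.
have e2 : d x / E <= d x.
  apply: (Rmult_le_reg_l E); first lra.
  have -> : E * (d x / E) = d x by field; lra.
  nra.
have e0 : 0 < eps by rewrite /eps; lra.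
have [eta [eta0 he]] := sqdet_lb e0.
have [gam [g0 hg]] := velocity_flow x eta0 (df_1 D) (df_2 D).
have [v hv] : exists v : R -> Rn n, forall t j, 0 <= t ->
    is_derive (fun s => gam s j) t (v t j) /\
    (t <= 1 -> in_box rho (gam t) -> v t j = velocity eta g1 g2 t (gam t) j).
  have H t : exists y : Rn n, forall j, 0 <= t -> is_derive (fun s => gam s j) t (y j) /\
    (t <= 1 -> in_box rho (gam t) -> y j = velocity eta g1 g2 t (gam t) j).
    apply: (@fin_choice n R (fun j y => 0 <= t -> is_derive (fun s => gam s j) t y /\
      (t <= 1 -> in_box rho (gam t) -> y = velocity eta g1 g2 t (gam t) j))) => j.
    case: (Rle_dec 0 t) => t0; last by exists 0.
    by have [y hy] := hg t j t0; exists y.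
  exists (fun t => proj1_sig (constructive_indefinite_description _ (H t))) => t j.
  by case: constructive_indefinite_description => y hy /=; exact: hy.
have we : 0 < w * eps ^ (r + 1) by apply: Rmult_lt_0_compat => //; exact: pow_lt.
(* All inequalities are strict and the horn has the fixed width w eps^(r+1), so [Q] is an open
   condition by mere continuity. *)
pose Q s := vnorm (gam s) < rho /\ eps < d (gam s) /\
  vnorm (mix s g1 g2 (gam s)) < w * eps ^ (r + 1).
have horn s : Q s -> vnorm (mix s g1 g2 (gam s)) <= w * d (gam s) ^ (r + 1).
  move=> [_ [q2 q3]]; apply: Rle_trans (Rlt_le _ _ q3) _.
  by apply: Rmult_le_compat_l; [lra|apply: pow_incr; lra].
have sd s : 0 <= s <= 1 -> Q s -> eta <= sqdet g1 g2 s (gam s).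
  by move=> hs Qs; have hh := horn s Qs; case: Qs => q1 [q2 q3]; apply: he => //; lra.
have vel s j : 0 <= s <= 1 -> Q s ->
    v s j = velocity eta g1 g2 s (gam s) j /\ Rabs (v s j) <= K * d (gam s).
  move=> hs Qs; have hh := horn s Qs; have hsd := sd s hs Qs; case: Qs => q1 [q2 q3].
  have [|_ vE] := hv s j; first lra.
  rewrite vE; [|lra|exact: in_box_ball].
  by split=> //; apply: velocity_le => //; lra.
have mixd s k : 0 <= s -> vnorm (gam s) < rho ->
    is_derive (fun s => mix s g1 g2 (gam s) k) s
     (sumR (fun m => mixjac s g1 g2 (gam s) k m * v s m) + (g2 (gam s) k - g1 (gam s) k)).
  move=> s0 hs; apply: mix_derive (df_1 D) (df_2 D) hs _ => j.
  by case: (hv s j s0).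
(* The self-improving step: [Q] before [T] gives at [T] the stronger facts d >= d(x)/E and F_T = 0.
   With [T = 0] it also starts the induction. *)
have good T : 0 <= T <= 1 -> (forall s, 0 <= s < T -> Q s) ->
    vnorm (gam T) < rho /\ d x / E <= d (gam T) /\ mix T g1 g2 (gam T) = @vzero p.
  move=> hT QT.
  have B a : Sigma a -> vdist (gam T) a <= E * vdist x a /\ vdist x a <= E * vdist (gam T) a.
    move=> Sa; rewrite -g0; apply: (contract_to_Sigma (v := v)) => // s j hs.
      by apply: (proj1 (hv s j _)); lra.
    by have [||_ h] := vel s j _ (QT s _); [lra|lra|exact: h].
  have R1 : vnorm (gam T) < rho.
    by have [b _] := B _ Sigma0; rewrite !vdistx0 in b; lra.
  split=> //; split.
    apply: (dist_set_ge Sigma0) => a Sa; have [_ b] := B a Sa.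
    have b' := dist_set_le x Sa; apply: (Rmult_le_reg_l E); first lra.
    have -> : E * (d x / E) = d x by field; lra.
    lra.
  apply: functional_extensionality => k.
  have := @derive_abs_le (fun s => mix s g1 g2 (gam s) k) (fun _ => 0)
    (fun s => sumR (fun m => mixjac s g1 g2 (gam s) k m * v s m) +
       (g2 (gam s) k - g1 (gam s) k))
    (fun _ => 0) T (proj1 hT).
  rewrite Rminus_diag {3}/mix g0 gx /vzero => H.
  suff : Rabs (mix T g1 g2 (gam T) k - ((1 - 0) * 0 + 0 * g2 x k)) <= 0.
    move=> h; have h' := Rabs_pos (mix T g1 g2 (gam T) k - ((1 - 0) * 0 + 0 * g2 x k)).
    by have := @Rabs_eq_0 (mix T g1 g2 (gam T) k - ((1 - 0) * 0 + 0 * g2 x k)); lra.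
  apply: H => s hs.
  - apply: mixd; first lra.
    case: (Req_dec s T) => [->//|ne].
    by have [] := QT s; first lra.
  - exact: is_derive_const.
  - have Qs := QT s ltac:(lra).
    have hs1 : 0 <= s <= 1 by lra.
    have -> : sumR (fun m => mixjac s g1 g2 (gam s) k m * v s m) =
        sumR (fun m => mixjac s g1 g2 (gam s) k m * velocity eta g1 g2 s (gam s) m).
      by apply: eq_sumR => m; have [-> _] := vel s m hs1 Qs.
    rewrite velocity_kills ?Rabs_R0; [exact: Rle_refl|exact: eta0|exact: sd].
have goodQ T : vnorm (gam T) < rho /\ d x / E <= d (gam T) /\
    mix T g1 g2 (gam T) = @vzero p -> Q T.
  by move=> [q1 [q2 q3]]; split=> //; split; [rewrite /eps; lra|rewrite q3 vnorm_vzero].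
have Qall : forall t, 0 <= t <= 1 -> Q t.
  apply: real_induction.
  - by apply: goodQ; apply: good => [|s hs]; lra.
  - move=> t ht [q1 [q2 q3]].
    have D1 j : is_derive (fun s => gam s j) t (v t j).
      by apply: (proj1 (hv t j _)); lra.
    have [|d1 [d10 h1]] := curve_cont (eps := Rmin (rho - vnorm (gam t)) (d (gam t) - eps)) D1.
      by apply: Rmin_pos; lra.
    have [|d2 [d20 h2]] := @curve_cont p (fun s => mix s g1 g2 (gam s)) (fun k => sumR (fun m =>
        mixjac t g1 g2 (gam t) k m * v t m) + (g2 (gam t) k - g1 (gam t) k)) t
        (w * eps ^ (r + 1) - vnorm (mix t g1 g2 (gam t))) (fun k => mixd t k (proj1 ht) q1).
      lra.
    exists (Rmin d1 d2); split; first exact: Rmin_pos.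
    move=> s hs; have m1 := Rmin_l d1 d2; have m2 := Rmin_r d1 d2.
    have hst : Rabs (s - t) < Rmin d1 d2 by rewrite Rabs_pos_eq; lra.
    have {}h1 := h1 s ltac:(lra); have {}h2 := h2 s ltac:(lra).
    have m3 := Rmin_l (rho - vnorm (gam t)) (d (gam t) - eps).
    have m4 := Rmin_r (rho - vnorm (gam t)) (d (gam t) - eps).
    have t1 := vdist_triangle (gam t) (gam s) (@vzero n).
    have t2 := dist_set_lip Sigma0 (gam t) (gam s).
    have t3 := vdist_triangle (mix t g1 g2 (gam t)) (mix s g1 g2 (gam s)) (@vzero p).
    rewrite !vdistx0 in t1 t3; rewrite (vdist_sym (gam t)) in t2.
    by split; [lra|split; lra].
  - by move=> T hT h; apply: goodQ; apply: good => //; lra.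
exists gam; split=> // t ht; have [|q1 [q2 q3]] := good t ht.
  by move=> s hs; apply: Qall; lra.
split=> //; split=> //; split; first lra.
move=> j; have [vE _] := vel t j ht (Qall t ht); have [|dv _] := hv t j; first lra.
by rewrite /velocity -(lift_field_eta _ (sd t ht (Qall t ht))) -[lift_field _ _ _ _]vE.
Qed.

(** * The time-one map and the homeomorphism *)

Definition transport g1 g2 x y :=
  (Sigma x /\ y = x) \/ (~ Sigma x /\ exists gam, gam 0 = x /\ gam 1 = y /\ traj g1 g2 gam).

Lemma transport_swap g1 g2 x y : transport g1 g2 x y -> transport g2 g1 y x.
Proof.
case=> [[Sx ->]|[nS [gam [<- [<- h]]]]]; first by left.
right; split.
  have [|_ [_ [h1 _]]] := h 1; first lra.
  by move=> /(dist_set_eq0 Sigma0); lra.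
exists (fun t => gam (1 - t)); rewrite Rminus_0_r Rminus_diag; split=> //; split=> //.
exact: traj_swap.
Qed.

Lemma transport_exists g1 g2 x : deformation g1 g2 -> vnorm x < rho / E ->
  g1 x = @vzero p -> exists y, transport g1 g2 x y.
Proof.
move=> D hx gx; case: (classic (Sigma x)) => Sx; first by exists x; left.
have [gam [g0 h]] := traj_exists D hx gx Sx.
by exists (gam 1); right; split=> //; exists gam.
Qed.

Lemma transport_le g1 g2 x y a : deformation g1 g2 -> transport g1 g2 x y -> Sigma a ->
  vdist y a <= E * vdist x a.
Proof.
move=> D [[Sx ->]|[nS [gam [<- [<- h]]]]] Sa.
  have := E_ge1; have := vdist_ge0 x a; nra.
by apply: (proj1 (traj_bounds D h Sa _)); lra.
Qed.

(** On [Sigma] the distance vanishes, so [df_diff] forces g2 = g1 there; elsewhere F_1 = g2 is zero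
    at the end of the trajectory. *)
Lemma transport_zero g1 g2 x y : deformation g1 g2 -> transport g1 g2 x y ->
  vnorm x < rho -> g1 x = @vzero p -> g2 y = @vzero p.
Proof.
move=> D [[Sx ->]|[nS [gam [<- [<- h]]]]] hx gx; apply: functional_extensionality => k.
  have := df_diff D k hx; rewrite (dist_set_eq0 Sigma0 Sx) gx addn1 /vzero /=.
  rewrite Rmult_0_l Rmult_0_r.
  by move=> H; have := @Rabs_eq_0 (g2 x k - 0); have := Rabs_pos (g2 x k - 0); lra.
have [|_ [h1 _]] := h 1; first lra.
by have := f_equal (fun u : Rn p => u k) h1; rewrite /mix => <-; ring.
Qed.

(** At a point of [Sigma] the linear bound [transport_le] handles neighbours on and off [Sigma]
    alike. Off [Sigma] the trajectories depend on their starting point in a Lipschitz way. *)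
Lemma transport_continuous g1 g2 x y e : deformation g1 g2 -> transport g1 g2 x y -> 0 < e ->
  exists eta, 0 < eta /\ forall x' y', transport g1 g2 x' y' -> vdist x' x < eta ->
    vdist y' y < e.
Proof.
move=> D Hxy e0; have E1 := E_ge1; case: Hxy => [[Sx ->]|[nS [gam [<- [<- h]]]]].
  exists (e / E); split; first by apply: Rdiv_lt_0_compat; lra.
  move=> x' y' H' hx; apply: Rle_lt_trans (transport_le D H' Sx) _.
  have := Rmult_lt_compat_l E _ _ ltac:(lra) hx.
  by have -> : E * (e / E) = e by field; lra.
have [|_ [_ [d0 _]]] := h 0; first lra.
(* Starting points near x have distance at least d(x)/2, so all their trajectories keep distance
   d(x)/2/E and share one constant [M]. *)
have e1 : 0 < d (gam 0) / 2 / E by apply: Rdiv_lt_0_compat; lra.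
have [M [M0 hM]] := traj_dep D e1.
have eM : 0 < e / M by apply: Rdiv_lt_0_compat.
exists (Rmin (d (gam 0) / 2) (e / M)); split; first by apply: Rmin_pos; lra.
move=> x' y' H' hx; have m1 := Rmin_l (d (gam 0) / 2) (e / M).
have m2 := Rmin_r (d (gam 0) / 2) (e / M).
have dx' : d (gam 0) / 2 < d x'.
  by have := dist_set_lip Sigma0 (gam 0) x'; rewrite vdist_sym; lra.
case: H' => [[Sx' _]|[_ [sig [s0 [<- hs]]]]].
  by have := dist_set_eq0 Sigma0 Sx'; lra.
have far c T : traj g1 g2 c -> d (gam 0) / 2 <= d (c 0) -> 0 <= T <= 1 ->
    d (gam 0) / 2 / E <= d (c T).
  move=> hc hd hT; apply: Rle_trans (traj_dist D hc hT).
  by apply: Rmult_le_compat_r => //; apply: Rlt_le; apply: Rinv_0_lt_compat; lra.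
apply: Rle_lt_trans (hM sig gam hs h _ _) _.
- by move=> t ht; apply: far => //; rewrite s0; lra.
- by move=> t ht; apply: far => //; lra.
rewrite s0; have := Rmult_lt_compat_l M _ _ M0 (Rlt_le_trans _ _ _ hx m2).
by have -> : M * (e / M) = e by field; lra.
Qed.

(** Uniqueness is continuity applied to two images of the same point. *)
Lemma transport_functional g1 g2 x y y' : deformation g1 g2 ->
  transport g1 g2 x y -> transport g1 g2 x y' -> y' = y.
Proof.
move=> D H H'; apply: vdist0; apply: Rle_antisym; last exact: vdist_ge0.
apply: Rnot_lt_le => lt; have [eta [eta0 h]] := transport_continuous D H lt.
by have := h _ _ H'; rewrite vdistxx => /(_ eta0); lra.
Qed.

Theorem deformation_equiv g1 g2 : deformation g1 g2 -> SigmaV_equiv Sigma g1 g2.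
Proof.
move=> D; have D' := deformation_swap D; have E1 := E_ge1.
(* Two shrinkings: transport is defined on the ball of radius [r1], and it sends the ball of radius
   [ra] into that of radius [r1], where the way back is defined. *)
set r1 := rho / E; set ra := r1 / E.
have r10 : 0 < r1 by apply: Rdiv_lt_0_compat; lra.
have ra0 : 0 < ra by apply: Rdiv_lt_0_compat; lra.
have Er : E * r1 = rho by rewrite /r1; field; lra.
have Ea : E * ra = r1 by rewrite /ra; field; lra.
have r1r : r1 <= rho by nra.
have rar : ra <= r1 by nra.
pose h x := epsilon (inhabits x) (transport g1 g2 x).
pose h' y := epsilon (inhabits y) (transport g2 g1 y).
have hE x y : transport g1 g2 x y -> h x = y.
  move=> H; apply: (transport_functional D H).
  by apply: (epsilon_spec (inhabits x) (transport g1 g2 x)); exists y.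
have hE' y x : transport g2 g1 y x -> h' y = x.
  move=> H; apply: (transport_functional D' H).
  by apply: (epsilon_spec (inhabits y) (transport g2 g1 y)); exists x.
have nle g g' x y : deformation g g' -> transport g g' x y -> vnorm y <= E * vnorm x.
  by move=> Dg H; have := transport_le Dg H Sigma0; rewrite !vdistx0.
(* The target neighbourhood collects the points whose backward image lies in the source ball. The
   condition binds only at zeros of [g2], which leaves room for the set to be open. *)
exists (rn_ball ra), (fun y => vnorm y < r1 /\
  (g2 y = @vzero p -> forall x, transport g2 g1 y x -> vnorm x < ra)), h, h'.
split; first exact: rn_ball_open.
split; first by rewrite /rn_ball vnorm_vzero.
split.
  move=> y [hy Hy]; have [e1 [e10 b1]] := rn_ball_open hy.
  case: (classic (g2 y = @vzero p)) => gy.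
    have [x Hx] := transport_exists D' hy gy.
    have hx := Hy gy x Hx.
    have [|e2 [e20 c2]] := transport_continuous (e := ra - vnorm x) D' Hx; first lra.
    exists (Rmin e1 e2); split; first exact: Rmin_pos.
    move=> z hz; have m1 := Rmin_l e1 e2; have m2 := Rmin_r e1 e2.
    split; first by apply: b1; lra.
    move=> _ x' Hx'; have := c2 _ _ Hx' ltac:(lra).
    by have := vdist_triangle x x' (@vzero n); rewrite !vdistx0; lra.
  (* Off the zero set, [g2] has no zeros nearby, so the second condition holds vacuously around
     y. *)
  have [k gk] : exists k, g2 y k <> 0.
    apply: NNPP => H; apply: gy; apply: functional_extensionality => k.
    by apply: NNPP => H'; apply: H; exists k.
  have yr : rn_ball rho y by rewrite /rn_ball; lra.
  have [e2 [e20 c2]] := Cs_cont (hd_C1 (df_2 D) k) yr (Rabs_pos_lt _ gk).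
  exists (Rmin e1 e2); split; first exact: Rmin_pos.
  move=> z hz; have m1 := Rmin_l e1 e2; have m2 := Rmin_r e1 e2.
  split; first by apply: b1; lra.
  move=> gz; have := c2 z ltac:(lra).
  by rewrite gz /vzero Rminus_0_l Rabs_Ropp; lra.
split.
  split; first by rewrite vnorm_vzero.
  by move=> _ x /(nle _ _ _ _ D'); rewrite vnorm_vzero; lra.
rewrite /=; split.
  move=> x [gx hx]; rewrite /rn_ball in hx.
  have [|y Hy] := transport_exists D _ gx; first by rewrite -/r1; lra.
  have ny := nle _ _ _ _ D Hy; rewrite (hE _ _ Hy).
  split; last by apply: hE'; exact: transport_swap.
  split; first by apply: transport_zero D Hy _ gx; lra.
  split; first nra.
  by move=> _ x' Hx'; rewrite -(hE' _ _ Hx') (hE' _ _ (transport_swap Hy)).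
split.
  move=> y [gy [hy Hy]]; have [x Hx] := transport_exists D' hy gy.
  rewrite (hE' _ _ Hx); split; last by apply: hE; exact: transport_swap.
  split; last exact: Hy.
  by apply: transport_zero D' Hx _ gy; lra.
split.
  move=> x [gx hx] e e0; rewrite /rn_ball in hx.
  have [|y Hy] := transport_exists D _ gx; first by rewrite -/r1; lra.
  have [eta [eta0 c]] := transport_continuous D Hy e0; exists eta; split=> //.
  move=> x' [gx' hx'] hd; rewrite /rn_ball in hx'.
  have [|y' Hy'] := transport_exists D _ gx'; first by rewrite -/r1; lra.
  by rewrite (hE _ _ Hy) (hE _ _ Hy'); exact: c Hy' hd.
split.
  move=> y [gy [hy _]] e e0; have [x Hx] := transport_exists D' hy gy.
  have [eta [eta0 c]] := transport_continuous D' Hx e0; exists eta; split=> //.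
  move=> y' [gy' [hy' _]] hd; have [x' Hx'] := transport_exists D' hy' gy'.
  by rewrite (hE' _ _ Hx) (hE' _ _ Hx'); exact: c Hx' hd.
by move=> x _ Sx; apply: hE; left.
Qed.

End Transport.

(** * The relative Kuo condition along the linear deformation *)

Lemma vnormZ n a (x y : Rn n) : (forall i, y i = a * x i) -> vnorm y = Rabs a * vnorm x.
Proof.
move=> h; rewrite -sqrt_Rsqr_abs -sqrt_mult_alt; last exact: Rle_0_sqr.
by rewrite -sumRZ; congr sqrt; apply: eq_sumR => i; rewrite h /Rsqr; ring.
Qed.

(** If u_i is nonzero, A^T u is u_i times the difference of grad f_i and a combination of the other
    gradients, with coefficients -u_j/u_i; the length of that difference is at least kappa. *)
Lemma kappa_le n p (f : Rn n -> Rn p) x u i :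
  kappa_df f x * Rabs (u i) <= vnorm (trmul (fun k m => grad f k x m) u).
Proof.
case: (Req_dec (u i) 0) => [->|ui]; first by rewrite Rabs_R0 Rmult_0_r; exact: vnorm_ge0.
pose S j t := exists c : 'I_p -> R, t = vdist (grad f j x)
  (fun m => sumR (fun l => if l == j then 0 else c l * grad f l x m)).
have S0 j t : S j t -> 0 <= t by case=> c ->; exact: vdist_ge0.
have Sin j : S j (vdist (grad f j x)
    (fun m => sumR (fun l => if l == j then 0 else 0 * grad f l x m))).
  by exists (fun _ => 0).
pose c j := - u j / u i.
set y := vdist (grad f i x)
  (fun m => sumR (fun l => if l == i then 0 else c l * grad f l x m)).
have : kappa_df f x <= y.
  apply: (Rle_trans _ (Rinf (S i))).
    apply: Rinf_le => [t [j ->]|]; last by exists i.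
    (* The outer infimum is usable only because each inner infimum is nonnegative. *)
    exact: (Rinf_ge (@S0 j) (Sin j) (@S0 j)).
  by apply: (Rinf_le (@S0 i)); exists c.
have -> : vnorm (trmul (fun k m => grad f k x m) u) = Rabs (u i) * y.
  apply: vnormZ => m; rewrite /trmul /vsub (sumRD1 _ i) Rmult_minus_distr_l -sumRZ.
  rewrite (_ : forall a b, a - b = a + (-1) * b); last by move=> a b; ring.
  rewrite -sumRZ; congr (_ + _); first ring.
  by apply: eq_sumR => l; case: (l == i); rewrite /c; field.
by move=> h; rewrite Rmult_comm; apply: Rmult_le_compat_l => //; exact: Rabs_pos.
Qed.

Lemma kappa_l1_le n p (f : Rn n -> Rn p) x u :
  kappa_df f x * l1norm u <= INR p * vnorm (trmul (fun k m => grad f k x m) u).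
Proof. by rewrite /l1norm -sumRZ -sumR_const; apply: ler_sumR => i; exact: kappa_le. Qed.

Lemma trmul_perturb n p (A B : 'I_p -> 'I_n -> R) u c :
  (forall k m, Rabs (B k m - A k m) <= c) ->
  vnorm (trmul B u) <= vnorm (trmul A u) + INR n * (c * l1norm u).
Proof.
move=> h; pose v : Rn n := fun m => sumR (fun k => (B k m - A k m) * u k).
have t : vnorm (trmul B u) <= vnorm (trmul A u) + vnorm v.
  by apply: vnorm_triangle => m; rewrite /v /trmul -sumRD; apply: eq_sumR => k; ring.
apply: Rle_trans t _; apply: Rplus_le_compat_l; apply: vnorm_le_coord => m.
apply: Rle_trans (Rabs_sumR _) _; rewrite /l1norm -sumRZ; apply: ler_sumR => k.
by rewrite Rabs_mult; apply: Rmult_le_compat_r; [exact: Rabs_pos|exact: h].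
Qed.

Lemma Rpower_neg_large delta N : 0 < delta -> 0 < N ->
  exists a, 0 < a /\ forall x, 0 < x < a -> N <= Rpower x (- delta).
Proof.
move=> d0 N0; exists (exp (- (ln N / delta))); split; first exact: exp_pos.
move=> x [x0 hx]; have l : ln x < - (ln N / delta).
  by rewrite -[X in _ < X]ln_exp; apply: ln_increasing.
rewrite /Rpower -[X in X <= _](exp_ln N) //; apply: Rlt_le; apply: exp_increasing.
have := Rmult_lt_compat_l _ _ _ d0 l.
have -> : delta * - (ln N / delta) = - ln N by field; lra.
lra.
Qed.

Section KuoDeformation.
Variables (n p r : nat) (Sigma : Rn n -> Prop) (f g1 g2 : Rn n -> Rn p).
Hypothesis Sigma_closed : rn_closed Sigma.
Hypothesis Sigma0 : Sigma (@vzero n).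
Hypothesis r0 : (0 < r)%N.
Hypothesis fg : germ_in (r + 1) f.
Hypothesis g1g : germ_in (r + 1) g1.
Hypothesis g2g : germ_in (r + 1) g2.
Hypothesis j1 : jet_eq Sigma r g1 f.
Hypothesis j2 : jet_eq Sigma r g2 f.
Hypothesis kuo : Kuo_delta Sigma r f.

(** * Estimates in powers of the distance to [Sigma] *)

Local Notation d := (dist_set Sigma).

(** The factor 2 makes up for a missing nearest point, and 3 = 1 + 2 keeps [a] near the origin,
    where the jets agree. A point of [Sigma] is its own companion, as no slack is left when d =
    0. *)
Lemma near_point x : exists a, Sigma a /\ vdist x a <= 2 * d x /\ vnorm a <= 3 * vnorm x.
Proof.
have dx : d x <= vnorm x by rewrite -vdistx0; exact: dist_set_le.
have x0 := vnorm_ge0 x; case: (classic (Sigma x)) => Sx.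
  exists x; split=> //; rewrite vdistxx (dist_set_eq0 Sigma0 Sx); lra.
have [a [Sa ha]] := dist_set_near Sigma0 x (dist_set_gt0 Sigma0 Sigma_closed Sx).
exists a; split=> //; split; first lra.
have := vdist_triangle x a (@vzero n); rewrite !vdistx0 (vdist_sym a); lra.
Qed.

Lemma common_ball : exists e, 0 < e /\ forall k,
  Cs (r + 1) (rn_ball e) (fun x => f x k) /\ Cs (r + 1) (rn_ball e) (fun x => g1 x k) /\
  Cs (r + 1) (rn_ball e) (fun x => g2 x k).
Proof.
have [_ [a [a0 ha]]] := fg; have [_ [b [b0 hb]]] := g1g; have [_ [c [c0 hc]]] := g2g.
have m1 := Rmin_l a (Rmin b c); have m2 := Rmin_r a (Rmin b c).
have m3 := Rmin_l b c; have m4 := Rmin_r b c.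
exists (Rmin a (Rmin b c)); split; first by apply: Rmin_pos => //; exact: Rmin_pos.
move=> k; split; first by apply: Cs_sub (ha k) => x; rewrite /rn_ball; lra.
by split; [apply: Cs_sub (hb k)|apply: Cs_sub (hc k)] => x; rewrite /rn_ball; lra.
Qed.

(** The Taylor estimate at a point of [Sigma] within 2 d(x) of [x]; the factor 2^m goes into the
    constant. *)
Lemma dist_estimate m e (F G : Rn n -> R) : 0 < e ->
  Cs m (rn_ball e) F -> Cs m (rn_ball e) G ->
  (exists e1, 0 < e1 /\ forall a, Sigma a -> vnorm a < e1 ->
     forall l, (size l < m)%N -> pdl l F a = pdl l G a) ->
  large_small (fun K rho => forall x, vnorm x < rho -> Rabs (F x - G x) <= K * d x ^ m).
Proof.
move=> e0 hF hG [e1 [e10 hj]]; have [K [rho [K0 [rho0 T]]]] := taylor e0 hF hG.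
have m0 : 0 < Rmin rho e1 by exact: Rmin_pos.
have m1 := Rmin_l rho e1; have m2 := Rmin_r rho e1.
have p0 : 0 < 2 ^ m by apply: pow_lt; lra.
exists (K * 2 ^ m), (Rmin rho e1 / 3); split; first by apply: Rmult_le_pos; lra.
split; first lra.
move=> K' rho' hK hr x hx; have [a [Sa [ha na]]] := near_point x.
have x0 := vnorm_ge0 x; have d0 := dist_set_ge0 Sigma0 x.
apply: Rle_trans (T K rho (Rle_refl K) _ a x (2 * d x) _ _ _ _ _) _.
- by split=> //; exact: Rle_refl.
- by move=> j; have := coord_le_vnorm a j; lra.
- by move=> j; have := coord_le_vnorm x j; lra.
- by apply: hj => //; lra.
- by move=> j; apply: Rle_trans (coord_le_vdist x a j) _.
- lra.
rewrite Rpow_mult_distr -Rmult_assoc; apply: Rmult_le_compat_r => //; exact: pow_le.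
Qed.

Lemma diff_estimate : large_small (fun K rho => forall k x, vnorm x < rho ->
  Rabs (g2 x k - g1 x k) <= K * d x ^ (r + 1)).
Proof.
have [e [e0 he]] := common_ball; apply: large_small_fin => k.
have [_ [h1 h2]] := he k; apply: (dist_estimate e0 h2 h1).
have [a [a0 ha]] := j1; have [b [b0 hb]] := j2.
have m1 := Rmin_l a b; have m2 := Rmin_r a b.
exists (Rmin a b); split; first exact: Rmin_pos.
move=> x Sx hx l; rewrite addn1 ltnS => hl.
by rewrite hb //; [rewrite ha //; lra|lra].
Qed.

Lemma grad_estimate g : germ_in (r + 1) g -> jet_eq Sigma r g f ->
  large_small (fun K rho => forall k m x, vnorm x < rho ->
    Rabs (grad g k x m - grad f k x m) <= K * d x ^ r).
Proof.
move=> [_ [a [a0 ha]]] [b [b0 hb]]; have [_ [c [c0 hc]]] := fg.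
have m1 := Rmin_l a c; have m2 := Rmin_r a c; have m0 : 0 < Rmin a c by exact: Rmin_pos.
apply: large_small_fin => k; apply: large_small_fin => m.
have ob := @rn_ball_open n (Rmin a c).
have CC h : Cs (r + 1) (rn_ball (Rmin a c)) h -> Cs r (rn_ball (Rmin a c)) (pd m h).
  by rewrite addn1 => H; exact: (proj2 (Cs_pd m ob H)).
apply: (dist_estimate m0 (F := pd m (fun y => g y k)) (G := pd m (fun y => f y k))).
- by apply: CC; apply: Cs_sub (ha k) => x; rewrite /rn_ball; lra.
- by apply: CC; apply: Cs_sub (hc k) => x; rewrite /rn_ball; lra.
exists b; split=> // x Sx hx l hl; rewrite -!pdl_rcons; apply: hb => //.
by rewrite size_rcons.
Qed.

Lemma half_deformation_small (g : Rn n -> Rn p) : germ_in (r + 1) g ->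
  large_small (fun K rho => half_deformation K rho g).
Proof.
move=> [_ [a [a0 ha]]]; have ob := @rn_ball_open n a.
have H1 : large_small (fun K rho => forall k, lip_box K rho (fun x => g x k)).
  apply: large_small_fin => k; apply: lipschitz_near0 a0 _.
  by apply: Cs_le (ha k); rewrite addn1.
have H2 : large_small (fun K rho => forall k m, lip_box K rho (fun x => grad g k x m)).
  apply: large_small_fin => k; apply: large_small_fin => m; apply: lipschitz_near0 a0 _.
  (* Here r >= 1 matters: the maps are C^2, so their gradients are C^1 and thus Lipschitz. *)
  apply: (proj2 (Cs_pd m ob _)); apply: Cs_le (ha k); by rewrite addn1.
have H3 : large_small (fun K rho => rho <= a).
  by exists 0, a; split; [lra|split=> // K' rho' _ []].
apply: large_small_imp (large_small_and H3 (large_small_and H1 H2)).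
move=> K rho K0 rho0 [h3 [h1 h2]]; split=> // k.
apply: Cs_sub (Cs_le _ (ha k)); last by rewrite addn1.
by move=> x; rewrite /rn_ball; lra.
Qed.

Lemma mix_germ t : germ_in (r + 1) (mix t g1 g2).
Proof.
split.
  apply: functional_extensionality => k; rewrite /mix (proj1 g1g) (proj1 g2g) /vzero; ring.
have [e [e0 he]] := common_ball; exists e; split=> // k.
have [_ [h1 h2]] := he k; exact: Cs_lin.
Qed.

Lemma mix_jet t : jet_eq Sigma r (mix t g1 g2) f.
Proof.
have [e [e0 he]] := common_ball; have [a [a0 ha]] := j1; have [b [b0 hb]] := j2.
have m1 := Rmin_l e (Rmin a b); have m2 := Rmin_r e (Rmin a b).
have m3 := Rmin_l a b; have m4 := Rmin_r a b.
exists (Rmin e (Rmin a b)); split; first by apply: Rmin_pos => //; exact: Rmin_pos.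
move=> x Sx hx l k hl; have [_ [h1 h2]] := he k.
have xe : rn_ball e x by rewrite /rn_ball; lra.
have hl' : (size l <= r + 1)%N by rewrite addn1; exact: leqW.
rewrite (pdl_lin (1 - t) t (@rn_ball_open n e) xe hl' h1 h2).
rewrite ha //; last lra.
rewrite hb //; last lra.
ring.
Qed.

(** The Kuo constants depend on the realisation, so they are taken for F_t alone and then used for
    nearby s: a thinner horn of F_s lies in the horn of F_t, and both Jacobians are within K d^r of
    df. *)
Lemma nondeg_local t : exists tau w alpha, 0 < tau /\ 0 < w /\ 0 < alpha /\
  forall s x, 0 <= s <= 1 -> Rabs (s - t) < tau -> vnorm x < alpha ->
    vnorm (mix s g1 g2 x) <= w * d x ^ (r + 1) -> nondeg (mixjac s g1 g2 x) (d x ^ r).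
Proof.
have [C [al [de [w [C0 [al0 [de0 [w0 hk]]]]]]]] := kuo (mix_germ t) (mix_jet t).
have [K1 [r1 [K10 [r10 /(_ K1 r1 (Rle_refl K1)) D]]]] := diff_estimate.
have {}D := D (conj r10 (Rle_refl r1)).
have [K2 [r2 [K20 [r20 G]]]] := large_small_and
  (grad_estimate g1g j1) (grad_estimate g2g j2).
have {G} [G1 G2] := G K2 r2 (Rle_refl K2) (conj r20 (Rle_refl r2)).
have p0 := pos_INR p; have n0 := pos_INR n.
(* From kappa >= (B + 1) d^r, summing over coordinates (factor p) and passing from df to D_s (loss p
   n K2 d^r) leaves (p + 1) d^r, enough for p d^r. The radius [a] makes C d^(-delta) exceed B +
   1. *)
set B := INR p * (1 + INR n * K2).
have B0 : 0 <= B by apply: Rmult_le_pos => //; have := Rmult_le_pos _ _ n0 K20; lra.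
have [|a [a0 ha]] := @Rpower_neg_large de ((B + 1) / C) de0.
  by apply: Rdiv_lt_0_compat; lra.
have pK : 0 <= INR p * K1 by exact: Rmult_le_pos.
have q0 : 0 < 2 * (INR p * K1 + 1) by lra.
pose alpha := Rmin (Rmin al a) (Rmin r1 r2).
(* For such s, |F_t - F_s| <= |t - s| p K1 d^(r+1) <= (w/2) d^(r+1), so half the width of the horn
   is kept in reserve. *)
exists (w / (2 * (INR p * K1 + 1))), (w / 2), alpha.
split; first exact: Rdiv_lt_0_compat.
split; first lra.
split; first by apply: Rmin_pos; exact: Rmin_pos.
move=> s x hs st hx hm u.
have [x1 [x2 [x3 x4]]] : vnorm x < al /\ vnorm x < a /\ vnorm x < r1 /\ vnorm x < r2.
  have := Rmin_l (Rmin al a) (Rmin r1 r2); have := Rmin_r (Rmin al a) (Rmin r1 r2).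
  have := Rmin_l al a; have := Rmin_r al a; have := Rmin_l r1 r2; have := Rmin_r r1 r2.
  by rewrite -/alpha; lra.
have d0 := dist_set_ge0 Sigma0 x; have l0 := l1norm_ge0 u.
(* On [Sigma] the required bound is 0, since r > 0. *)
case: (Req_dec (d x) 0) => [dz|dnz].
  rewrite dz pow_i ?Rmult_0_l; [exact: vnorm_ge0|exact/ltP].
have {d0} d0 : 0 < d x by lra.
have dr : 0 < d x ^ r by exact: pow_lt.
have dr1 : 0 < d x ^ (r + 1) by exact: pow_lt.
have dx : d x <= vnorm x by rewrite -vdistx0; exact: dist_set_le.
(* The final inequality is divided by p, so p = 0 is settled apart. *)
case: (Req_dec (INR p) 0) => [pz|pnz].
  have -> : l1norm u = 0.
    apply: Rle_antisym => //; have := @ler_sumR p (fun k => Rabs (u k)) (fun _ => l1norm u).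
    rewrite sumR_const pz Rmult_0_l; apply=> k; apply: (@term_le_sumR p (fun k => Rabs (u k))).
    by move=> j; exact: Rabs_pos.
  by rewrite Rmult_0_r; exact: vnorm_ge0.
have horn : vnorm (mix t g1 g2 x) <= w * d x ^ (r + 1).
  have T : vnorm (mix t g1 g2 x) <= vnorm (mix s g1 g2 x) +
      vnorm (fun k : 'I_p => (t - s) * (g2 x k - g1 x k)).
    by apply: vnorm_triangle => k; rewrite /mix; ring.
  have H k : Rabs ((t - s) * (g2 x k - g1 x k)) <=
      w / (2 * (INR p * K1 + 1)) * (K1 * d x ^ (r + 1)).
    rewrite Rabs_mult Rabs_minus_sym; apply: Rmult_le_compat; try exact: Rabs_pos; first lra.
    exact: D.
  have := vnorm_le_coord (x := fun k => (t - s) * (g2 x k - g1 x k)) H.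
  have E : INR p * (w / (2 * (INR p * K1 + 1)) * (K1 * d x ^ (r + 1))) =
     w / 2 * d x ^ (r + 1) * (INR p * K1 / (INR p * K1 + 1)) by field; lra.
  have F : INR p * K1 / (INR p * K1 + 1) <= 1.
    by apply/Rle_div_l; lra.
  rewrite E; have : 0 < w / 2 * d x ^ (r + 1) by nra.
  move=> ? ?; nra.
have := hk x x1 horn; rewrite /rpow; case: Rlt_dec => [dp|//] /= kap.
have {kap} kap : (B + 1) * d x ^ r <= kappa_df f x.
  apply: Rle_trans (Rge_le _ _ kap).
  have -> : INR r - de = INR r + - de by ring.
  rewrite Rpower_plus Rpower_pow //.
  have := ha (d x) ltac:(lra) => H.
  have : (B + 1) <= C * Rpower (d x) (- de).
    apply: Rle_trans (Rmult_le_compat_l _ _ _ (Rlt_le _ _ C0) H).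
    by apply: Req_le; field; lra.
  move=> q; have := Rmult_le_compat_r _ _ _ (Rlt_le _ _ dr) q; lra.
have J k m : Rabs (grad f k x m - mixjac s g1 g2 x k m) <= K2 * d x ^ r.
  have := G1 k m x x4; have := G2 k m x x4; rewrite /mixjac => q2 q1.
  have -> : grad f k x m - ((1 - s) * grad g1 k x m + s * grad g2 k x m) =
   - ((1 - s) * (grad g1 k x m - grad f k x m) + s * (grad g2 k x m - grad f k x m)) by ring.
  rewrite Rabs_Ropp; apply: Rle_trans (Rabs_triang _ _) _; rewrite !Rabs_mult.
  by rewrite (Rabs_pos_eq (1 - s)) ?(Rabs_pos_eq s); [nra|lra|lra].
have P := trmul_perturb u J; have Q := kappa_l1_le f x u.
have pp : 0 < INR p by lra.
apply: (Rmult_le_reg_l (INR p)) => //.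
have kl : (B + 1) * d x ^ r * l1norm u <= kappa_df f x * l1norm u.
  exact: Rmult_le_compat_r.
have pP := Rmult_le_compat_l _ _ _ p0 P.
have dl : 0 <= d x ^ r * l1norm u by nra.
rewrite /B in kl; nra.
Qed.

(** Real induction on [T] for the existence of constants valid on [0, T]: finitely many minima of
    local constants replace a finite subcover. *)
Lemma nondeg_uniform : exists w alpha, 0 < w /\ 0 < alpha /\
  forall s x, 0 <= s <= 1 -> vnorm x < alpha ->
    vnorm (mix s g1 g2 x) <= w * d x ^ (r + 1) -> nondeg (mixjac s g1 g2 x) (d x ^ r).
Proof.
pose P T w alpha := 0 < w /\ 0 < alpha /\ forall s x, 0 <= s <= 1 -> s <= T ->
  vnorm x < alpha -> vnorm (mix s g1 g2 x) <= w * d x ^ (r + 1) ->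
  nondeg (mixjac s g1 g2 x) (d x ^ r).
(* Uniform constants on [[0, T]] extend past any [t] close to [T]. *)
have ext t : exists tau, 0 < tau /\ forall T s, t - tau < T -> s < t + tau ->
    (exists w alpha, P T w alpha) -> exists w alpha, P s w alpha.
  have [tau [w' [al' [tau0 [w'0 [al'0 h']]]]]] := nondeg_local t.
  exists tau; split=> // T s hT hs [w [al [w0 [al0 h]]]].
  have m1 := Rmin_l w w'; have m2 := Rmin_r w w'.
  have m3 := Rmin_l al al'; have m4 := Rmin_r al al'.
  exists (Rmin w w'), (Rmin al al'); split; first exact: Rmin_pos.
  split; first exact: Rmin_pos.
  move=> u x hu us hx hm.
  have dr : 0 <= d x ^ (r + 1) by apply: pow_le; exact: dist_set_ge0 Sigma0 x.
  case: (Rle_dec u T) => uT; first by apply: h => //; [lra|nra].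
  by apply: h' => //; [apply: Rabs_def1; lra|lra|nra].
have Q : forall t, 0 <= t <= 1 -> exists w alpha, P t w alpha.
  apply: real_induction.
  - have [tau [w [al [tau0 [w0 [al0 h]]]]]] := nondeg_local 0.
    exists w, al; split=> //; split=> // s x hs hs' hx hm; apply: h => //.
    by rewrite Rabs_pos_eq; lra.
  - move=> t ht Qt; have [tau [tau0 h]] := ext t; exists tau; split=> // s hs.
    by apply: (h t) => //; lra.
  - move=> T hT Qs; have [tau [tau0 h]] := ext T.
    apply: (h (Rmax 0 (T - tau / 2))); [|lra|].
      by apply: Rlt_le_trans (Rmax_r _ _); lra.
    by apply: Qs; split; [exact: Rmax_l|apply: Rmax_lub_lt; lra].
have [|w [al [w0 [al0 h]]]] := Q 1; first lra.
by exists w, al; split=> //; split=> // s x hs; apply: h => //; lra.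
Qed.

Lemma kuo_deformation : exists K w rho, 0 <= K /\ 0 < w /\ 0 < rho /\
  deformation r Sigma K w rho g1 g2.
Proof.
have [w [al [w0 [al0 hn]]]] := nondeg_uniform.
have [K [rho [K0 [rho0 H]]]] := large_small_and diff_estimate
  (large_small_and (half_deformation_small g1g) (half_deformation_small g2g)).
have m1 := Rmin_l rho al; have m2 := Rmin_r rho al.
have m0 : 0 < Rmin rho al by exact: Rmin_pos.
exists K, w, (Rmin rho al); split=> //; split=> //; split=> //.
have [hd [h1 h2]] := H K (Rmin rho al) (Rle_refl K) (conj m0 m1).
split=> // [x k hx|t x ht hx]; first exact: hd.
by apply: hn => //; lra.
Qed.

End KuoDeformation.

Theorem theorem5p9 (n p r : nat) (Sigma : Rn n -> Prop) (f : Rn n -> Rn p) :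
  rn_closed Sigma -> Sigma (vzero n) ->
  (0 < r)%nat -> (p <= n)%nat ->
  germ_in (r + 1) f ->
  Kuo_delta Sigma r f ->
  SigmaV_sufficient Sigma r (r + 1) f.
Proof.
move=> cl S0 r0 _ fg kuo g1 g2 g1g g2g j1 j2.
have [K [w [rho [K0 [w0 [rho0 D]]]]]] := kuo_deformation cl S0 r0 fg g1g g2g j1 j2 kuo.
exact: (deformation_equiv cl S0 K0 w0 rho0 D).
Qed.
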